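(* Let $p\in(1,\infty)$. The family $(T_N)_{N\geq 1}$ of countably branching trees (each equipped with its hyperbolic distance) does not equi-Lipschitz embed into the James space $\mathcal{J}_p$, and it does not equi-Lipschitz embed into its dual $\mathcal{J}_p^*$.
   Context: James space: for $p\in(1,\infty)$, the $p$-variation of a sequence $x=(x_n)_{n\geq 1}$ of scalars is the quantity $\|x\|_{\mathcal{J}_p}$ defined by $$\|x\|_{\mathcal{J}_p}^p=\sup_{k\geq 1}\ \sup_{1\leq n_1<\dots<n_k}\ \sum_{i=1}^{k-1} |x_{n_{i+1}}-x_{n_i}|^p .$$ $\mathcal{J}_p$ is the subspace of $c_0$ consisting of all sequences of finite $p$-variation, endowed with the norm $\|\cdot\|_{\mathcal{J}_p}$. $\mathcal{J}_p^*$ is its Banach space dual. Countably branching trees: for $N\geq 1$, $T_N=\{\emptyset\}\cup\bigcup_{n=1}^N\mathbb{N}^n$ is the set of sequences of integers of length at most $N$. For $s\in T_N$, $|s|$ is the length of $s$ (with $|\emptyset|=0$), and for $s,t\in T_N$, $a_{s,t}$ is their greatest common ancestor, i.e. their longest common initial segment. The hyperbolic distance on $T_N$ is $d(s,t)=|s|+|t|-2|a_{s,t}|$. Equi-Lipschitz embedding: a family of metric spaces $(M_i,d_i)_{i\in I}$ equi-Lipschitz embeds into a metric space $(N,\delta)$ if there are maps $f_i:M_i\to N$ $(i\in I)$ and constants $a,b>0$ (independent of $i$) such that $a\,d_i(x,y)\leq \delta(f_i(x),f_i(y))\leq b\,d_i(x,y)$ for all $i\in I$ and all $x,y\in M_i$.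 *)

(* Defs.v *)
From HB Require Import structures.
From mathcomp Require Import all_boot all_order all_algebra.
From mathcomp Require Import zify ring lra.
From mathcomp Require Import all_classical all_reals all_analysis.
From mathcomp Require Import complex.

Set Implicit Arguments.
Unset Strict Implicit.
Unset Printing Implicit Defensive.

Import Order.TTheory GRing.Theory Num.Theory.
Import numFieldNormedType.Exports.

Local Open Scope classical_set_scope.
Local Open Scope ring_scope.

Variant scalar_kind := RealScalars | ComplexScalars.

Definition scalar_field (R : realType) (k : scalar_kind) : numFieldType :=
  match k with RealScalars => R | ComplexScalars => R[i] end.

(* The scalars are either the real or the complex numbers.
   The norm of a numFieldType takes its values in the field itself, so over the
   complex scalars `|z| lives in R[i].  [modulus] is the corresponding real
   number, and [ofreal] is the embedding of R into the scalars. *)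
Definition modulus (R : realType) (k : scalar_kind) : scalar_field R k -> R :=
  match k return scalar_field R k -> R with
  | RealScalars => fun x => `|x|
  | ComplexScalars => fun z => Normc.normc z
  end.

Definition ofreal (R : realType) (k : scalar_kind) : R -> scalar_field R k :=
  match k return R -> scalar_field R k with
  | RealScalars => fun x => x
  | ComplexScalars => fun x => (x%:C)%C
  end.
Arguments ofreal {R} k x.

Section ScalarTheory.
Variables (R : realType) (k : scalar_kind).
Implicit Types (x y : scalar_field R k) (a b : R).

Lemma normE x : `|x| = ofreal k (modulus x).
Proof. by case: k x => //= -[]. Qed.

Lemma ofrealD a b : ofreal k (a + b) = ofreal k a + ofreal k b.
Proof. by case: k => //; exact: (rmorphD (real_complex R)). Qed.

Lemma ofrealM a b : ofreal k (a * b) = ofreal k a * ofreal k b.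
Proof. by case: k => //; exact: (rmorphM (real_complex R)). Qed.

Lemma ofreal0 : ofreal k (0 : R) = 0.
Proof. by case: k. Qed.

Lemma ofreal1 : ofreal k (1 : R) = 1.
Proof. by case: k. Qed.

Lemma ler_ofreal a b : (ofreal k a <= ofreal k b) = (a <= b).
Proof. by case: k => //=; rewrite lecR. Qed.

Lemma ofreal_inj : injective (@ofreal R k).
Proof. by move=> a b ab; apply/eqP; rewrite eq_le -!ler_ofreal ab lexx. Qed.

Lemma modulus_ge0 x : 0 <= modulus x.
Proof. by rewrite -ler_ofreal ofreal0 -normE. Qed.

Lemma modulusD x y : modulus (x + y) <= modulus x + modulus y.
Proof. by rewrite -ler_ofreal ofrealD -!normE ler_normD. Qed.

Lemma modulusM x y : modulus (x * y) = modulus x * modulus y.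
Proof. by apply: ofreal_inj; rewrite ofrealM -!normE normrM. Qed.

Lemma modulus0 : modulus (0 : scalar_field R k) = 0.
Proof. by apply: ofreal_inj; rewrite -normE normr0 ofreal0. Qed.

Lemma modulus1 : modulus (1 : scalar_field R k) = 1.
Proof. by apply: ofreal_inj; rewrite -normE normr1 ofreal1. Qed.

Lemma modulus0_eq0 x : modulus x = 0 -> x = 0.
Proof. by move=> x0; apply/eqP; rewrite -normr_eq0 normE x0 ofreal0. Qed.

End ScalarTheory.

Section EquiLipschitz.
Variable K : numFieldType.

(* When K is complex, the order on K makes [0 < a] mean that a is a positive
   real number, and the distances are real numbers seen in K. *)
Definition equi_lipschitz_embeds (I : Type) (M : I -> metricType K)
    (N : metricType K) : Prop :=
  exists (f : forall i, M i -> N) (a b : K), [/\ 0 < a, 0 < b &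
    forall i (x y : M i),
      a * mdist x y <= mdist (f i x) (f i y) <= b * mdist x y].

End EquiLipschitz.

Section Tree.
Implicit Types s t u : seq nat.

(* The longest common initial segment. *)
Fixpoint ancestor s t : seq nat :=
  match s, t with
  | x :: s', y :: t' => if x == y then x :: ancestor s' t' else [::]
  | _, _ => [::]
  end.

Lemma prefix_ancestor u s t :
  prefix u (ancestor s t) = prefix u s && prefix u t.
Proof.
elim: s t u => [|x s IHs] [|y t] [|z u] //=; rewrite ?andbF ?prefix0s//.
case: (eqVneq x y) => [<-|xy] /=.
  by rewrite IHs; case: (z == x).
by case: (eqVneq z x) => [->|] //=; rewrite (negPf xy) /= andbF.
Qed.

Lemma ancestorC s t : ancestor s t = ancestor t s.
Proof.
elim: s t => [|x s IHs] [|y t] //=.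
by rewrite eq_sym; case: eqP => // ->; rewrite IHs.
Qed.

Lemma ancestorxx s : ancestor s s = s.
Proof. by elim: s => //= x s ->; rewrite eqxx. Qed.

Lemma size_ancestorl s t : (size (ancestor s t) <= size s)%N.
Proof.
elim: s t => [|x s IHs] [|y t] //=; case: eqP => //= _.
by rewrite ltnS IHs.
Qed.

Lemma size_ancestorr s t : (size (ancestor s t) <= size t)%N.
Proof. by rewrite ancestorC size_ancestorl. Qed.

Lemma size_ancestor_eq s t :
  size (ancestor s t) = size s -> size (ancestor s t) = size t -> s = t.
Proof.
elim: s t => [|x s IHs] [|y t] //=; case: eqP => //= -> [e1] [e2].
by rewrite (IHs t).
Qed.

Lemma size_ancestor_min s t u :
  (minn (size (ancestor s t)) (size (ancestor t u)) <= size (ancestor s u))%N.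
Proof.
elim: s t u => [|x s IHs] [|y t] [|z u] //=; rewrite ?minn0 ?min0n//.
case: (eqVneq x y) => [<-|]; case: (eqVneq _ z) => //= _; rewrite ?min0n ?minn0//.
by rewrite minnSS ltnS IHs.
Qed.

(* The truncated subtraction is harmless by [size_ancestorl] and
   [size_ancestorr]. *)
Definition hyperbolic_dist s t : nat :=
  size s + size t - 2 * size (ancestor s t).

Lemma hyperbolic_distxx s : hyperbolic_dist s s = 0%N.
Proof. by rewrite /hyperbolic_dist ancestorxx; lia. Qed.

Lemma hyperbolic_dist_eq0 s t : hyperbolic_dist s t = 0%N -> s = t.
Proof.
rewrite /hyperbolic_dist => st.
have := size_ancestorl s t; have := size_ancestorr s t => ? ?.
by apply: size_ancestor_eq; lia.
Qed.

Lemma hyperbolic_distC s t : hyperbolic_dist s t = hyperbolic_dist t s.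
Proof. by rewrite /hyperbolic_dist ancestorC addnC. Qed.

Lemma hyperbolic_dist_triangle t s u :
  (hyperbolic_dist s u <= hyperbolic_dist s t + hyperbolic_dist t u)%N.
Proof.
rewrite /hyperbolic_dist.
have := size_ancestorl s t; have := size_ancestorr s t.
have := size_ancestorl t u; have := size_ancestorr t u.
have := size_ancestor_min s t u; lia.
Qed.

End Tree.

(* The tree T_N; the field K only serves to fix where its distance takes
   its values. *)
Definition tree (K : numFieldType) (N : nat) : Type :=
  {s : seq nat | (size s <= N)%N}.

HB.instance Definition _ (K : numFieldType) (N : nat) :=
  Choice.copy (tree K N) {s : seq nat | (size s <= N)%N}.

Section TreeMetric.
Variables (K : numFieldType) (N : nat).
Implicit Types s t u : tree K N.

Definition tree_dist s t : K := (hyperbolic_dist (val s) (val t))%:R.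

Let tree_distxx s : tree_dist s s = 0.
Proof. by rewrite /tree_dist hyperbolic_distxx. Qed.

Let tree_dist_eq0 s t : tree_dist s t = 0 -> s = t.
Proof.
by move/eqP; rewrite pnatr_eq0 => /eqP/hyperbolic_dist_eq0; exact: val_inj.
Qed.

Let tree_distC s t : tree_dist s t = tree_dist t s.
Proof. by rewrite /tree_dist hyperbolic_distC. Qed.

Let tree_dist_triangle t s u : tree_dist s u <= tree_dist s t + tree_dist t u.
Proof. by rewrite -natrD ler_nat hyperbolic_dist_triangle. Qed.

HB.instance Definition _ := isMetric.Build K (tree K N)
  tree_distxx tree_dist_eq0 tree_distC tree_dist_triangle.

End TreeMetric.

(* Sequences are indexed from 0 instead of 1. *)
Section Variation.
Variables (R : realType) (k : scalar_kind).
Implicit Types (x y : nat -> scalar_field R k) (s : seq nat) (p : R).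

Definition variation_sum p x s : R :=
  \sum_(0 <= i < (size s).-1)
    modulus (x (nth 0%N s i.+1) - x (nth 0%N s i)) `^ p.

(* The p-th power of the p-variation; s ranges over the nonempty lists
   n_1 < ... < n_k. *)
Definition variation p x : \bar R :=
  ereal_sup [set (variation_sum p x s)%:E |
    s in [set s | (0 < size s)%N /\ sorted ltn s]].

Definition james_norm p x : R := fine (variation p x) `^ p^-1.

End Variation.

Section VariationTheory.
Variables (R : realType) (k : scalar_kind) (p : R) (p1 : 1 < p).
Implicit Types (x y : nat -> scalar_field R k) (s : seq nat).

Let p0 : 0 < p. Proof. exact: lt_trans p1. Qed.
Let pN0 : p != 0. Proof. by rewrite gt_eqF. Qed.

Lemma variation_sum_ge0 x s : 0 <= variation_sum p x s.
Proof. by apply: sumr_ge0 => i _; exact: powR_ge0. Qed.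

Lemma variation_sum_le x s : (0 < size s)%N -> sorted ltn s ->
  ((variation_sum p x s)%:E <= variation p x)%E.
Proof. by move=> s0 ss; apply: ereal_sup_ubound; exists s. Qed.

Lemma variation_ge0 x : (0 <= variation p x)%E.
Proof.
apply: le_trans (@variation_sum_le x [:: 0%N] isT isT).
by rewrite lee_fin variation_sum_ge0.
Qed.

Lemma variationK x : (variation p x < +oo)%E ->
  (fine (variation p x))%:E = variation p x.
Proof. by move=> xfin; rewrite fineK// ge0_fin_numE// variation_ge0. Qed.

Lemma james_norm_ge0 x : 0 <= james_norm p x.
Proof. exact: powR_ge0. Qed.

Lemma james_normX x : (variation p x < +oo)%E ->
  (james_norm p x `^ p)%:E = variation p x.
Proof.
move=> xfin; rewrite /james_norm -powRrM mulVf// powRr1 ?variationK//.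
by rewrite fine_ge0// variation_ge0.
Qed.

Lemma james_norm_le x a : 0 <= a ->
  (variation p x <= (a `^ p)%:E)%E -> james_norm p x <= a.
Proof.
move=> a0 xa; have xfin : (variation p x < +oo)%E by rewrite (le_lt_trans xa)// ltry.
rewrite -(@powRr1 _ a)// -(mulfV pN0) powRrM.
apply: ge0_ler_powR; rewrite ?nnegrE ?powR_ge0 ?invr_ge0 ?(ltW p0)//.
  by rewrite fine_ge0// variation_ge0.
by rewrite -lee_fin variationK.
Qed.

Lemma variationD x y a b : 0 < a -> 0 < b ->
  (variation p x <= (a `^ p)%:E)%E -> (variation p y <= (b `^ p)%:E)%E ->
  (variation p (x \+ y)%R <= ((a + b) `^ p)%:E)%E.
Proof.
move=> a0 b0 xa yb; have ab0 : 0 < a + b by exact: addr_gt0.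
apply: ge_ereal_sup => _ [s [s0 ss] <-]; rewrite lee_fin.
pose t := a / (a + b).
have t01 : 0 <= t <= 1.
  by rewrite /t divr_ge0 ?(ltW a0) ?(ltW ab0)//= ler_pdivrMr// mul1r lerDl ltW.
have /andP[t0 t1] := t01.
have tB : 1 - t = b / (a + b).
  by rewrite /t; field; rewrite gt_eqF.
have xs : variation_sum p x s <= a `^ p.
  by rewrite -lee_fin (le_trans _ xa)// variation_sum_le.
have ys : variation_sum p y s <= b `^ p.
  by rewrite -lee_fin (le_trans _ yb)// variation_sum_le.
have powR_div (c d : R) : 0 <= c -> 0 < d -> (c / d) `^ p = c `^ p / d `^ p.
  move=> c0 d0; have dp0 : d `^ p != 0 by rewrite gt_eqF// powR_gt0.
  apply: (mulIf dp0); rewrite divfK// -powRM ?divr_ge0 ?(ltW d0)//.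
  by rewrite divfK ?gt_eqF.
have key (u v : R) : 0 <= u -> 0 <= v ->
    (u + v) `^ p <= (a + b) `^ p * (t * (u `^ p / a `^ p) + (1 - t) * (v `^ p / b `^ p)).
  move=> u0 v0.
  have ua0 : 0 <= u / a by rewrite divr_ge0// ltW.
  have vb0 : 0 <= v / b by rewrite divr_ge0// ltW.
  have -> : u + v = (a + b) * (t * (u / a) + (1 - t) * (v / b)).
    by rewrite tB /t; field; rewrite !gt_eqF.
  rewrite powRM ?(ltW ab0)//; last first.
    by rewrite addr_ge0// mulr_ge0// subr_ge0.
  rewrite ler_wpM2l ?powR_ge0//.
  rewrite -!powR_div//.
  have := @convex_powR R p (ltW p1) (Itv01 t0 t1) (u / a) (v / b).
  rewrite !inE/= !in_itv/= !andbT => /(_ ua0 vb0).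
  by rewrite convRE [X in X `^ _ <= _ -> _]convRE.
rewrite /variation_sum.
apply: (@le_trans _ _ (\sum_(0 <= i < (size s).-1) (a + b) `^ p *
   (t * (modulus (x (nth 0%N s i.+1) - x (nth 0%N s i)) `^ p / a `^ p) +
   (1 - t) * (modulus (y (nth 0%N s i.+1) - y (nth 0%N s i)) `^ p / b `^ p)))).
  apply: ler_sum => i _; apply: le_trans (key _ _ (modulus_ge0 _) (modulus_ge0 _)).
  apply: ge0_ler_powR; rewrite ?nnegrE ?(ltW p0) ?addr_ge0 ?modulus_ge0//.
  by apply: le_trans (modulusD _ _); rewrite /= opprD addrACA.
rewrite -mulr_sumr big_split/= -!mulr_sumr -!mulr_suml.
rewrite -[leRHS]mulr1 ler_wpM2l ?powR_ge0//.
rewrite -[leRHS](subrK t) addrC.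
apply: lerD; rewrite -[leRHS]mulr1 ler_wpM2l ?subr_ge0// ler_pdivrMr ?powR_gt0// mul1r//.
Qed.

Lemma variationZ x (l : scalar_field R k) :
  variation p (fun n => l * x n) = ((modulus l `^ p)%:E * variation p x)%E.
Proof.
rewrite /variation -ereal_supZl ?powR_ge0//; last first.
  by apply/set0P; exists (variation_sum p x [:: 0%N])%:E, [:: 0%N].
congr ereal_sup; rewrite image_comp; apply: eq_imagel => s _ /=.
rewrite -EFinM /variation_sum mulr_sumr; congr EFin.
apply: eq_bigr => i _.
by rewrite -mulrBr modulusM powRM ?modulus_ge0.
Qed.

Lemma variation_cst0 : variation p (fun=> 0 : scalar_field R k) = 0%E.
Proof.
rewrite (_ : (fun=> 0) = (fun n : nat => 0 * (0 : scalar_field R k))).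
  by rewrite (variationZ (fun=> 0)) modulus0 powR0// mul0e.
by apply/funext => n; rewrite mul0r.
Qed.

Lemma james_normZ x (l : scalar_field R k) : (variation p x < +oo)%E ->
  james_norm p (fun n => l * x n) = modulus l * james_norm p x.
Proof.
move=> xfin; rewrite /james_norm variationZ -[variation p x in LHS]variationK//=.
rewrite powRM ?powR_ge0// ?fine_ge0 ?variation_ge0//.
by rewrite -powRrM mulfV// powRr1 ?modulus_ge0.
Qed.

Lemma variation_le_james_norm x e : 0 < e -> (variation p x < +oo)%E ->
  (variation p x <= ((james_norm p x + e) `^ p)%:E)%E.
Proof.
move=> e0 xfin; rewrite -james_normX// lee_fin.
apply: ge0_ler_powR; rewrite ?nnegrE ?(ltW p0) ?james_norm_ge0//.
  by rewrite addr_ge0 ?james_norm_ge0 ?(ltW e0).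
by rewrite lerDl (ltW e0).
Qed.

Lemma variationD_james_norm x y e : 0 < e ->
  (variation p x < +oo)%E -> (variation p y < +oo)%E ->
  (variation p (x \+ y)%R <=
    ((james_norm p x + e + (james_norm p y + e)) `^ p)%:E)%E.
Proof.
by move=> e0 xfin yfin; apply: variationD;
  rewrite ?variation_le_james_norm ?ltr_wpDl ?james_norm_ge0.
Qed.

Lemma variationD_lty x y :
  (variation p x < +oo)%E -> (variation p y < +oo)%E ->
  (variation p (x \+ y)%R < +oo)%E.
Proof.
move=> xfin yfin.
by rewrite (le_lt_trans (variationD_james_norm ltr01 xfin yfin)) ?ltry.
Qed.

Lemma james_normD x y :
  (variation p x < +oo)%E -> (variation p y < +oo)%E ->
  james_norm p (x \+ y)%R <= james_norm p x + james_norm p y.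
Proof.
move=> xfin yfin; apply/ler_addgt0Pr => e e0.
have e20 : 0 < e / 2 by rewrite divr_gt0.
rewrite [e]splitr addrACA; apply: james_norm_le.
  by rewrite !addr_ge0 ?james_norm_ge0 ?(ltW e20).
exact: variationD_james_norm.
Qed.

Lemma modulus_le_james_norm x m n : (variation p x < +oo)%E ->
  (m < n)%N -> modulus (x n - x m) <= james_norm p x.
Proof.
move=> xfin mn.
have : ((modulus (x n - x m) `^ p)%:E <= variation p x)%E.
  have := @variation_sum_le x [:: m; n] isT.
  by rewrite /variation_sum/= andbT => /(_ mn); rewrite big_nat1.
rewrite -james_normX// lee_fin => le_p.
rewrite -(@powRr1 _ (modulus _)) ?modulus_ge0// -(@powRr1 _ (james_norm p x)).
  rewrite -(mulfV pN0) !powRrM.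
  by apply: ge0_ler_powR; rewrite ?nnegrE ?powR_ge0 ?invr_ge0 ?(ltW p0).
exact: james_norm_ge0.
Qed.

Lemma james_norm_eq0 x : x @ \oo --> (0 : scalar_field R k) ->
  (variation p x < +oo)%E -> james_norm p x = 0 -> x = (fun=> 0).
Proof.
move=> x0 xfin nx0.
have eqx m n : (m < n)%N -> x n = x m.
  move=> mn; apply/eqP; rewrite -subr_eq0; apply/eqP/modulus0_eq0.
  apply/eqP; rewrite eq_le modulus_ge0 andbT -nx0.
  exact: modulus_le_james_norm.
have xE n : x n = x 0%N by case: n => [//|n]; exact: eqx.
have {}x0 : (fun=> x 0%N) @ \oo --> (0 : scalar_field R k).
  by rewrite (_ : (fun=> _) = x)//; apply/funext => n; rewrite xE.
apply/funext => n; rewrite xE.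
have := @cvg_unique _ (@norm_hausdorff _ (scalar_field R k)) (x 0%N @[_ --> \oo]) _ _ _ x0 (cvg_cst _).
by move=> /(_ _) ->.
Qed.

End VariationTheory.

Definition is_james (R : realType) (k : scalar_kind) (p : R)
    (x : nat -> scalar_field R k) : Prop :=
  x @ \oo --> (0 : scalar_field R k) /\ (variation p x < +oo)%E.

(* The argument p1 makes the set of sequences closed under the vector space
   operations, so that instances can be attached to it. *)
Definition is_james_pred (R : realType) (k : scalar_kind) (p : R) (p1 : 1 < p) :
  {pred nat -> (scalar_field R k)^o} := mem [set x | is_james p x].
Arguments is_james_pred {R} k {p} p1.

Section JamesClosed.
Variables (R : realType) (k : scalar_kind) (p : R) (p1 : 1 < p).

Let james_closed : submod_closed (is_james_pred k p1).
Proof.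
split=> [|l x y]; rewrite !inE/=.
  by split; [exact: cvg_cst|rewrite variation_cst0].
move=> [x0 xfin] [y0 yfin]; split.
  rewrite -[0](addr0 (0 : scalar_field R k)) -{1}(mulr0 l).
  by apply: cvgD => //; exact: cvgMr.
apply: variationD_lty => //.
rewrite variationZ lte_mul_pinfty ?lee_fin ?powR_ge0//.
Qed.

HB.instance Definition _ :=
  GRing.isSubmodClosed.Build _ _ (is_james_pred k p1) james_closed.

End JamesClosed.

Record james (R : realType) (k : scalar_kind) (p : R) (p1 : 1 < p) := James {
  james_seq :> nat -> (scalar_field R k)^o ;
  james_seqP : james_seq \in is_james_pred k p1
}.

Section JamesSpace.
Variables (R : realType) (k : scalar_kind) (p : R) (p1 : 1 < p).
Notation james := (james k p1).
Implicit Types x y : james.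

HB.instance Definition _ := [isSub for @james_seq R k p p1].
HB.instance Definition _ := [Choice of james by <:].
HB.instance Definition _ := [SubChoice_isSubLmodule of james by <:].

Lemma james_seq_cvg x : (x : nat -> scalar_field R k) @ \oo --> (0 : scalar_field R k).
Proof. by have := james_seqP x; rewrite inE => -[]. Qed.

Lemma james_seq_fin x : (variation p (x : nat -> scalar_field R k) < +oo)%E.
Proof. by have := james_seqP x; rewrite inE => -[]. Qed.

Let norm x : scalar_field R k := ofreal k (james_norm p x).

Let norm_normD x y : norm (x + y) <= norm x + norm y.
Proof. by rewrite -ofrealD ler_ofreal james_normD ?james_seq_fin. Qed.

Let norm_normZ (l : scalar_field R k) x : norm (l *: x) = `|l| * norm x.
Proof. by rewrite normE -ofrealM -james_normZ ?james_seq_fin. Qed.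

Let norm_eq0 x : norm x = 0 -> x = 0.
Proof.
rewrite -(ofreal0 R k) => /ofreal_inj x0; apply: val_inj.
by apply: (james_norm_eq0 p1) x0; [exact: james_seq_cvg|exact: james_seq_fin].
Qed.

HB.instance Definition _ :=
  Lmodule_isNormed.Build (scalar_field R k) james norm_normD norm_normZ norm_eq0.

Lemma james_normE x : `|x| = ofreal k (james_norm p x).
Proof. by []. Qed.

End JamesSpace.

Section NormMetric.
Variables (K : numFieldType) (V : normedModType K).

Definition norm_dist (x y : V) : K := `|x - y|.

Lemma norm_dist_ge0 x y : 0 <= norm_dist x y.
Proof. exact: normr_ge0. Qed.

Lemma norm_dist_eq0 x y : norm_dist x y = 0 -> x = y.
Proof. by move/normr0_eq0/eqP; rewrite subr_eq0 => /eqP. Qed.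

Lemma ballE_norm_dist x r : ball x r = [set y | norm_dist x y < r].
Proof. by rewrite -ball_normE. Qed.

End NormMetric.

HB.instance Definition _ (R : realType) (k : scalar_kind) (p : R) (p1 : 1 < p) :=
  PseudoMetric_isMetric.Build (scalar_field R k) (james k p1)
    (@norm_dist_ge0 _ (james k p1)) (@norm_dist_eq0 _ (james k p1))
    (@ballE_norm_dist _ (james k p1)).

Definition is_dual_pred (R : realType) (k : scalar_kind)
    (V : normedModType (scalar_field R k)) : {pred V -> (scalar_field R k)^o} :=
  mem [set f | linear f /\ continuous f].
Arguments is_dual_pred {R k} V.

Section DualClosed.
Variables (R : realType) (k : scalar_kind) (V : normedModType (scalar_field R k)).

Let dual_closed : submod_closed (is_dual_pred V).
Proof.
split=> [|l f g]; rewrite !inE/=.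
  split; last by move=> x; exact: cvg_cst.
  by move=> a x y; rewrite /= scaler0 addr0.
move=> [lf cf] [lg cg]; split.
  move=> a x y; rewrite /= !fctE lf lg !scalerDr !scalerA mulrC.
  by rewrite -!addrA; congr (_ + _); rewrite addrCA.
by move=> x; apply: cvgD (cg x); apply: cvgZr; exact: cf.
Qed.

HB.instance Definition _ :=
  GRing.isSubmodClosed.Build _ _ (is_dual_pred V) dual_closed.

End DualClosed.

Record dual_space (R : realType) (k : scalar_kind)
    (V : normedModType (scalar_field R k)) := Dual {
  dual_fun :> V -> (scalar_field R k)^o ;
  dual_funP : dual_fun \in is_dual_pred V
}.

Section DualSpace.
Variables (R : realType) (k : scalar_kind) (V : normedModType (scalar_field R k)).
Implicit Types (f g : dual_space V) (x y : V).

HB.instance Definition _ := [isSub for @dual_fun R k V].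
HB.instance Definition _ := [Choice of dual_space V by <:].
HB.instance Definition _ := [SubChoice_isSubLmodule of dual_space V by <:].

Lemma dual_fun_linear f : linear f.
Proof. by have := dual_funP f; rewrite inE => -[]. Qed.

Lemma dual_fun_continuous f : continuous f.
Proof. by have := dual_funP f; rewrite inE => -[]. Qed.

Let values f : set R := [set modulus (f x) | x in [set x : V | `|x| <= 1]].

Definition dual_norm f : R := sup (values f).

Let packed f : {linear V -> (scalar_field R k)^o} :=
  HB.pack (dual_fun f) (GRing.isLinear.Build _ _ _ _ _ (@dual_fun_linear f)).

Let values_has_sup f : has_sup (values f).
Proof.
split.
  by exists (modulus (f 0)), 0 => //=; rewrite normr0.
have /linear_boundedP : bounded_near (packed f) (nbhs (0 : V)).
  by apply: continuous_linear_bounded; exact: dual_fun_continuous.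
move=> /pinfty_ex_gt0[M M0 fM]; exists (modulus M) => _ [x /= x1 <-].
rewrite -(ler_ofreal k) -!normE (gtr0_norm M0).
by rewrite (le_trans (fM x))// ler_piMr// ltW.
Qed.

Lemma dual_norm_ub f x : `|x| <= 1 -> modulus (f x) <= dual_norm f.
Proof. by move=> x1; apply: sup_upper_bound => //=; exists x. Qed.

Lemma dual_norm_le f (a : R) :
  (forall x, `|x| <= 1 -> modulus (f x) <= a) -> dual_norm f <= a.
Proof.
move=> fa; apply: ge_sup; first by case: (values_has_sup f).
by move=> _ [x /= x1 <-]; exact: fa.
Qed.

Lemma dual_norm_ge0 f : 0 <= dual_norm f.
Proof.
by rewrite (le_trans (modulus_ge0 (f 0)))// dual_norm_ub// normr0.
Qed.

Lemma dual_fun0 f : f 0 = 0.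
Proof. exact: (linear0 (packed f)). Qed.

Lemma dual_funZ f (a : scalar_field R k) x : f (a *: x) = a * f x.
Proof. exact: (linearZ_LR (packed f)). Qed.

Lemma dual_fun_le f x : `|f x| <= ofreal k (dual_norm f) * `|x|.
Proof.
have [->|x0] := eqVneq x 0; first by rewrite dual_fun0 !normr0 mulr0.
rewrite -ler_pdivrMr ?normr_gt0// -[X in _ / X]normr_id -normrV ?unitfE ?normr_eq0//.
rewrite mulrC -normrM -dual_funZ normE ler_ofreal dual_norm_ub//.
by rewrite normrZ normfV normr_id mulVf// normr_eq0.
Qed.

Let norm f : scalar_field R k := ofreal k (dual_norm f).

Let norm_normD f g : norm (f + g) <= norm f + norm g.
Proof.
rewrite -ofrealD ler_ofreal; apply: dual_norm_le => x x1.
by rewrite (le_trans (modulusD _ _))// lerD// dual_norm_ub.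
Qed.

Let dual_normZ_le (l : scalar_field R k) f :
  dual_norm (l *: f) <= modulus l * dual_norm f.
Proof.
apply: dual_norm_le => x x1.
by rewrite [modulus _](modulusM l (f x)) ler_wpM2l ?modulus_ge0 ?dual_norm_ub.
Qed.

Let norm_normZ (l : scalar_field R k) f : norm (l *: f) = `|l| * norm f.
Proof.
rewrite normE -ofrealM; congr ofreal; apply/eqP; rewrite eq_le dual_normZ_le/=.
have [->|l0] := eqVneq l 0; first by rewrite modulus0 mul0r dual_norm_ge0.
have ml0 : 0 < modulus l.
  rewrite lt_neqAle modulus_ge0 andbT eq_sym.
  by apply: contra l0 => /eqP/modulus0_eq0 ->.
rewrite mulrC -ler_pdivlMr// mulrC.
have {1}-> : f = l^-1 *: (l *: f) by rewrite scalerA mulVf// scale1r.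
rewrite (le_trans (dual_normZ_le _ _))//.
suff -> : modulus l^-1 = (modulus l)^-1 by [].
apply: (mulfI (lt0r_neq0 ml0)).
by rewrite -modulusM (mulfV l0) (mulfV (lt0r_neq0 ml0)) modulus1.
Qed.

Let norm_eq0 f : norm f = 0 -> f = 0.
Proof.
rewrite /norm => f0; apply/val_inj/funext => x /=.
by apply/eqP; rewrite -normr_le0 (le_trans (dual_fun_le f x))// f0 mul0r.
Qed.

HB.instance Definition _ :=
  Lmodule_isNormed.Build (scalar_field R k) (dual_space V) norm_normD norm_normZ norm_eq0.

Lemma dual_normE f : `|f| = ofreal k (dual_norm f).
Proof. by []. Qed.

End DualSpace.

HB.instance Definition _ (R : realType) (k : scalar_kind)
    (V : normedModType (scalar_field R k)) :=
  PseudoMetric_isMetric.Build (scalar_field R k) (dual_space V)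
    (@norm_dist_ge0 _ (dual_space V)) (@norm_dist_eq0 _ (dual_space V))
    (@ballE_norm_dist _ (dual_space V)).

Lemma james_mdistE (R : realType) (k : scalar_kind) (p : R) (p1 : 1 < p)
  (x y : james k p1) : mdist x y = `|x - y|.
Proof. by []. Qed.

Lemma dual_mdistE (R : realType) (k : scalar_kind)
  (V : normedModType (scalar_field R k)) (f g : dual_space V) :
  mdist f g = `|f - g|.
Proof. by []. Qed.

(* Main.v *)
From mathcomp Require Import all_boot all_order all_algebra.
From mathcomp Require Import zify ring lra.
From mathcomp Require Import all_classical all_reals all_analysis.
From mathcomp Require Import complex.
Require Import Defs.
Set Implicit Arguments.
Unset Strict Implicit.
Unset Printing Implicit Defensive.
Import Order.TTheory GRing.Theory Num.Theory.
Import numFieldNormedType.Exports.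
Local Open Scope ring_scope.

(** Elements of J_p and of its dual are replaced by scalar sequences: by the
    increments x_(n+1) - x_n of x in J_p, and by the values on the unit vectors
    of a functional on J_p. The norm becomes, up to constants, the supremum
    over b of W 0 b, where W a b is a seminorm that only sees the coordinates
    of index in [a, b). The record [interval_norm] lists what is used of W, and
    [tree_obstruction] says that no such norm admits equi-Lipschitz embeddings
    of the trees T_N.

    The obstruction is a self-improvement argument. Fix a nonprincipal
    ultrafilter on the integers and call typical what holds for almost every
    choice of the successive letters of a word. Let F embed T_N with constants
    alpha <= beta, and follow F along a typical branch, in blocks of l letters.
    The increment over a block splits into a head, carried by coordinates
    chosen before the block is, and a tail. The head hardly depends on the
    block, by compactness in finite dimension; as two blocks with distinct
    first letters give values at distance at least 2 alpha l, the tail has size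
    at least of order alpha l. Convexity of W then makes the head smaller than
    the whole increment by a fixed factor theta < 1. Over M consecutive blocks
    the heads add up to at most theta M times the size of one increment,
    whereas the tails live on successive intervals and add up to o(M) times
    that size, provided that the coordinates of every tail have sum 0. Hence
    the Lipschitz constant at scale M l is smaller than the one at scale l by a
    fixed factor, and after sufficiently many scales it is below alpha.

    The proviso is where the failure of reflexivity shows: J_p has codimension
    one in its bidual, and the sum of the coordinates of a typical tail of F is
    some number c. It depends on the level and on the length of the block, but
    not on the branch. So the argument is applied not to F but to
    G(s, t) = F(s) - F(t), where the letters of s and t are chosen alternately:
    both contributions c cancel, and G(s, t) is still at least 2 alpha N when s
    and t are branches with distinct first letters.

    For J_p, W is the p-variation on an interval ([james_inorm]). For the dual,
    W is the norm dual to an equivalent unit ball of J_p, chosen stable under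
    concatenation with coefficients s, t such that s^p + t^p <= 1; this gives
    W its convexity ([dual_inorm]). *)

(** * Scalars, real powers and monotone steps *)

Section Scalars.
Variables (R : realType) (k : scalar_kind).
Implicit Types (c : scalar_field R k) (r : R).

Lemma modulusN c : modulus (- c) = modulus c.
Proof. by apply: (@ofreal_inj R k); rewrite -!normE normrN. Qed.

Lemma modulus_ofreal r : 0 <= r -> modulus (ofreal k r : scalar_field R k) = r.
Proof.
move=> r0; apply: (@ofreal_inj R k).
by rewrite -normE ger0_norm// -(ofreal0 R k) ler_ofreal.
Qed.

Lemma ofreal_gt0 r : 0 < r -> 0 < ofreal k r.
Proof.
move=> r0; rewrite lt_neqAle -(ofreal0 R k) ler_ofreal (ltW r0) andbT.
by rewrite (inj_eq (@ofreal_inj R k)) lt_eqF.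
Qed.

Lemma ofreal_nat n : ofreal k (n%:R : R) = n%:R.
Proof.
by elim: n => [|n IH]; rewrite ?ofreal0// -!natr1 ofrealD ofreal1 IH.
Qed.

End Scalars.

Lemma ler_powR_base (R : realType) (r x y : R) : 0 < r -> 0 <= x -> 0 <= y ->
  x `^ r <= y `^ r -> x <= y.
Proof.
move=> r0 x0 y0; rewrite !leNgt; apply: contra => yx.
by apply: gt0_ltr_powR; rewrite ?nnegrE.
Qed.

Lemma powR_mul_pred (R : realType) (x p : R) : 0 < x -> x `^ p = x * x `^ (p - 1).
Proof.
move=> x0; rewrite -{2}[x]powRr1 ?ltW// -powRD ?(gt_eqF x0) ?implybT//.
by rewrite addrC subrK.
Qed.

Lemma leq_steps (m : nat -> nat) M : (forall i, (i < M)%N -> (m i <= m i.+1)%N) ->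
  forall i j, (i <= j)%N -> (j <= M)%N -> (m i <= m j)%N.
Proof.
move=> mle i; elim=> [|j IH]; first by rewrite leqn0 => /eqP->.
rewrite leq_eqVlt => /orP[/eqP->//|ij jM].
by rewrite (leq_trans (IH ij (ltnW jM)))// mle.
Qed.

(** * Products of ultrafilters *)

Section Ultra.
Local Open Scope classical_set_scope.

(** Products of ultrafilters are easily seen to decide every set; this turns
    that property into maximality. *)
Lemma ultra_dichotomy T (F : set_system T) :
  ProperFilter F -> (forall A, F A \/ F (~` A)) -> UltraFilter F.
Proof.
move=> FF FC; split=> // G GF FG; apply/seteqP; split=> [A GA|//].
case: (FC A) => // /FG GcA.
by exfalso; apply: (@filter_not_empty _ G); rewrite -(setICr A); apply: filterI.
Qed.

(** The iterated quantifier, G-almost every y for F-almost every x: the order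
    of the factors matters, and this is finer than the product filter. *)
Definition fubini T S (F : set_system T) (G : set_system S) : set_system (T * S) :=
  [set A | F [set x | G [set y | A (x, y)]]].

#[export] Instance fubini_ultra T S (F : set_system T) (G : set_system S) :
  UltraFilter F -> UltraFilter G -> UltraFilter (fubini F G).
Proof.
move=> FU GU; apply: ultra_dichotomy.
  apply: Build_ProperFilter_ex; first by move=> A /(@filter_ex _ F)[x] /filter_ex[y Axy]; exists (x, y).
  split.
  - by apply: (@filterE _ F) => x; apply: filterT.
  - by move=> A B; apply: (@filterS2 _ F) => x; apply: filterS2 => y.
  - by move=> A B AB; apply: (@filterS _ F) => x; apply: filterS => y; apply: AB.
move=> A; case: (in_ultra_setVsetC [set x | G [set y | A (x, y)]] FU) => FA; first by left.
right; apply: filterS FA => x /= nG.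
by case: (in_ultra_setVsetC [set y | A (x, y)] GU).
Qed.

Fixpoint upow T (F : set_system T) n : set_system (seq T) :=
  if n is n'.+1 then [set A | F [set x | upow F n' [set s | A (x :: s)]]]
  else [set A | A [::]].

#[export] Instance upow_ultra T (F : set_system T) n :
  UltraFilter F -> UltraFilter (upow F n).
Proof.
move=> FU; elim: n => [|n IH]; apply: ultra_dichotomy.
- apply: Build_ProperFilter_ex; first by move=> A FA; exists [::].
  by split=> // A B AB; apply: AB.
- by move=> A /=; case: (pselect (A [::])); [left|right].
- apply: Build_ProperFilter_ex; first by move=> A /(@filter_ex _ F)[x] /filter_ex[s As]; exists (x :: s).
  split.
  + by apply: (@filterE _ F) => x; apply: filterT.
  + by move=> A B; apply: (@filterS2 _ F) => x; apply: filterS2 => y.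
  + by move=> A B AB; apply: (@filterS _ F) => x; apply: filterS => y; apply: AB.
move=> A; case: (in_ultra_setVsetC [set x | upow F n [set s | A (x :: s)]] FU) => FA; first by left.
right; apply: filterS FA => x /= nG.
by case: (in_ultra_setVsetC [set y | A (x :: y)] IH).
Qed.

Lemma upow_size T (F : set_system T) n : UltraFilter F ->
  upow F n [set s | size s = n].
Proof.
move=> FU; elim: n => //= n IH.
by apply: (@filterE _ F) => x; apply: filterS IH => s /= ->.
Qed.

Lemma upow_cat T (F : set_system T) m n A :
  upow F (m + n) A = upow F m [set s | upow F n [set t | A (s ++ t)]].
Proof. by elim: m A => //= m IH A; congr F; apply/funext => x /=; rewrite IH. Qed.

(** A word of pairs is an interlaced pair of words: the letters are chosen in
    the order x_1, y_1, x_2, y_2, and so on. Each of the two words is typical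
    when the pair is. *)
Lemma upow_unzip1 T (F : set_system T) n A : UltraFilter F ->
  upow F n A -> upow (fubini F F) n [set w | A (unzip1 w)].
Proof.
move=> FU; elim: n A => //= n IH A; apply: filterS => x /IH Ax.
by apply: (@filterE _ F).
Qed.

Lemma upow_unzip2 T (F : set_system T) n A : UltraFilter F ->
  upow F n A -> upow (fubini F F) n [set w | A (unzip2 w)].
Proof.
move=> FU; elim: n A => //= n IH A FA.
apply: (@filterE _ F) => x.
by apply: filterS FA => y /IH Ax.
Qed.

(** Choosing the second letters simultaneously for A and B is possible because
    each choice is only constrained by a set of the ultrafilter. *)
Lemma upow_same_unzip2 T (F : set_system T) n A B : UltraFilter F ->
  upow (fubini F F) n A -> upow (fubini F F) n B ->
  exists u v, [/\ A u, B v & unzip2 u = unzip2 v].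
Proof.
move=> FU; elim: n A B => [|n IH] A B /=; first by exists [::], [::].
move=> /(@filter_ex _ F)[x Ax] /(@filter_ex _ F)[y By].
have [z [zA zB]] := filter_ex (filterI Ax By).
have [u [v [Au Bv uv]]] := IH _ _ zA zB.
by exists ((x, z) :: u), ((y, z) :: v); split => //=; rewrite uv.
Qed.

Lemma nonprincipal_ultrafilter : exists2 U : set_system nat,
  UltraFilter U & forall n, U [set i | (n < i)%N].
Proof.
have [U [UU sU]] := ultraFilterLemma eventually_filter.
by exists U => // n; apply: sU; exists n.+1.
Qed.

End Ultra.
Arguments upow : simpl never.

(** * Limits of bounded scalar functions along an ultrafilter *)

Section UltraLimit.
Local Open Scope classical_set_scope.
Variables (R : realType) (T : Type) (V : set_system T).
Hypothesis VU : UltraFilter V.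

Lemma real_ultra_limit (g : T -> R) (B : R) : V [set x | `|g x| <= B] ->
  exists l, forall e, 0 < e -> V [set x | `|g x - l| < e].
Proof.
move=> gB; have gU : UltraFilter (g @ V).
  by apply: ultra_dichotomy => A; exact: (in_ultra_setVsetC (g @^-1` A) VU).
have := @segment_compact R (- B) B; rewrite compact_ultra => /(_ _ gU) /=.
case; first by apply: filterS gB => x /=; rewrite in_itv/= ler_norml.
move=> l [_ gl]; exists l => e e0.
by move/cvgrPdist_lt : gl => /(_ _ e0); apply: filterS => x /=; rewrite distrC.
Qed.

Lemma scalar_ultra_limit (k : scalar_kind) (g : T -> scalar_field R k) (B : R) :
  V [set x | modulus (g x) <= B] ->
  exists l, forall e, 0 < e -> V [set x | modulus (g x - l) < e].
Proof.
case: k g => [g|g]; first exact: real_ultra_limit.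
have leRe (z : R[i]) : `|complex.Re z| <= Normc.normc z.
  by case: z => a b /=; rewrite -sqrtr_sqr ler_wsqrtr// lerDl sqr_ge0.
have leIm (z : R[i]) : `|complex.Im z| <= Normc.normc z.
  by case: z => a b /=; rewrite -sqrtr_sqr ler_wsqrtr// lerDr sqr_ge0.
have normc_le (z : R[i]) : Normc.normc z <= `|complex.Re z| + `|complex.Im z|.
  case: z => a b /=; rewrite -[leRHS]ger0_norm ?addr_ge0// -sqrtr_sqr ler_wsqrtr//.
  rewrite sqrrD !real_normK ?num_real// -addrA lerD2l lerDr.
  by rewrite mulrn_wge0// mulr_ge0.
move=> /= gB.
have [|a ga] := @real_ultra_limit (fun x => complex.Re (g x)) B.
  by apply: filterS gB => x /=; apply: le_trans.
have [|b gb] := @real_ultra_limit (fun x => complex.Im (g x)) B.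
  by apply: filterS gB => x /=; apply: le_trans.
exists (a +i* b)%C => e e0; have e2 : 0 < e / 2 by rewrite divr_gt0.
apply: filterS2 (ga _ e2) (gb _ e2) => x /= xa xb.
rewrite (le_lt_trans (normc_le _))// [ltRHS]splitr ltrD//.
  by case: (g x) xa.
by case: (g x) xb.
Qed.

End UltraLimit.

(** * Interval norms *)

(** In the space of sequences x with sup_b W 0 b x finite, [inorm_convex] is an
    asymptotic uniform convexity: a tail of norm proportional to that of x
    forces a smaller head. [inorm_blocks] is an asymptotic smoothness, for
    blocks whose coordinates have sum 0: M successive blocks add up to o(M).
    Without the condition on the sums this fails: M blocks of sum 1 have norm at
    least M / C together, by [sum_le_inorm]. *)
Record interval_norm (R : realType) (k : scalar_kind)
    (W : nat -> nat -> (nat -> scalar_field R k) -> R) (C : R) : Prop := {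
  inorm_ge0 : forall a b x, 0 <= W a b x ;
  inormD : forall a b x y, W a b (x + y) <= W a b x + W a b y ;
  inormN : forall a b x, W a b (- x) <= W a b x ;
  inorm_const_ge0 : 0 <= C ;
  inorm_le_sum : forall a b x, W a b x <= C * \sum_(a <= j < b) modulus (x j) ;
  sum_le_inorm : forall a b x, modulus (\sum_(a <= j < b) x j) <= C * W a b x ;
  inorm_mono : forall a' a b b' x,
    (a' <= a)%N -> (a <= b)%N -> (b <= b')%N -> W a b x <= W a' b' x ;
  inorm_cat : forall a b c x,
    (a <= b)%N -> (b <= c)%N -> W a c x <= W a b x + W b c x ;
  inorm_convex : forall kap, 0 < kap <= 1 ->
    exists2 theta, 0 <= theta < 1 & forall a b c x N,
      (a <= b)%N -> (b <= c)%N -> W a c x <= N -> kap * N <= W b c x ->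
      W a b x <= theta * N ;
  inorm_blocks : forall eps, 0 < eps -> exists2 M, (0 < M)%N &
    forall (m : nat -> nat) x B, (forall i, (i < M)%N -> (m i <= m i.+1)%N) ->
      (forall i, (i < M)%N -> \sum_(m i <= j < m i.+1) x j = 0) ->
      (forall i, (i < M)%N -> W (m i) (m i.+1) x <= B) ->
      W (m 0%N) (m M) x <= eps * M%:R * B
}.

Section IntervalNorm.
Variables (R : realType) (k : scalar_kind).
Variables (W : nat -> nat -> (nat -> scalar_field R k) -> R) (C : R).
Hypothesis IW : interval_norm W C.
Implicit Types (x y z : nat -> scalar_field R k) (a b c m n : nat).

Lemma inorm0 a b x : (forall j, (a <= j < b)%N -> x j = 0) -> W a b x = 0.
Proof.
move=> x0; apply/eqP; rewrite eq_le (inorm_ge0 IW) andbT.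
rewrite (le_trans (inorm_le_sum IW _ _ _))//.
by rewrite big_nat big1 ?mulr0// => j /x0->; rewrite modulus0.
Qed.

Lemma inormB a b x y : W a b (x - y) <= W a b x + W a b y.
Proof. by rewrite (le_trans (inormD IW _ _ _ _))// lerD2l (inormN IW). Qed.

Lemma inorm_le_ext a b x y : (forall j, (a <= j < b)%N -> x j = y j) ->
  W a b x <= W a b y.
Proof.
move=> xy; rewrite -[x](subrK y) (le_trans (inormD IW _ _ _ _))//.
by rewrite inorm0 ?add0r// => j /xy; rewrite !fctE => ->; rewrite subrr.
Qed.

Lemma inorm_sum a b (I : Type) (r : seq I) (P : pred I)
    (x : I -> nat -> scalar_field R k) :
  W a b (\sum_(i <- r | P i) x i) <= \sum_(i <- r | P i) W a b (x i).
Proof.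
elim/big_ind2 : _ => [|x1 x2 y1 y2 h1 h2|//]; first by rewrite inorm0.
by rewrite (le_trans (inormD IW _ _ _ _))// lerD.
Qed.

(** Otherwise there would be tails of norm at least eta arbitrarily far; by
    convexity all heads would then stay below a fraction theta < 1 of their
    supremum. *)
Lemma inorm_tail x (B : R) : (forall b, W 0 b x <= B) ->
  forall eta, 0 < eta -> exists m0, forall m b,
    (m0 <= m)%N -> (m <= b)%N -> W m b x <= eta.
Proof.
move=> xB eta eta0.
pose S := sup [set W 0 m x | m in setT]%classic.
have hS : has_sup [set W 0 m x | m in setT]%classic.
  by split; [exists (W 0 0 x), 0%N|exists B => _ [m _ <-]].
have leS m : W 0 m x <= S by apply: sup_upper_bound => //; exists m.
have [Seta|etaS] := leP S eta.
  exists 0%N => m b _ mb; rewrite (le_trans _ Seta)// (le_trans _ (leS b))//.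
  exact: (inorm_mono IW).
have S0 : 0 < S by exact: lt_trans etaS.
have [|theta /andP[theta0 theta1] Htheta] := @inorm_convex _ _ _ _ IW (eta / S).
  by rewrite divr_gt0//= ler_pdivrMr// mul1r ltW.
have d0 : 0 < S - theta * S by rewrite subr_gt0 gtr_pMl.
have [_ [m0 _ <-]] := sup_adherent d0 hS.
rewrite -/S opprB addrC subrK => m0S; exists m0 => m b m0m mb.
rewrite leNgt; apply/negP => ltW_.
have := Htheta 0%N m b x S (leq0n _) mb (leS b).
rewrite divfK ?gt_eqF// => /(_ (ltW ltW_)); rewrite leNgt => /negP; apply.
by rewrite (lt_le_trans m0S)// (inorm_mono IW).
Qed.

(** An increment x that has head at most h before m, negligible tail after m',
    and in between a block whose coordinates almost add up to 0. *)
Definition step_ok (h eta L : R) x m m' : Prop :=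
  [/\ (m < m')%N, W 0 m x <= h, forall b, (m' <= b)%N -> W m' b x <= eta,
    modulus (\sum_(m <= j < m') x j) <= eta & forall b, W 0 b x <= L].

(** The heads add up as in the triangle inequality, the blocks by
    [inorm_blocks]. The sums of the blocks are only almost 0: the sum e i is
    first removed from the coordinate of index m i. *)
Lemma inorm_steps (eps h eta L : R) M (x : nat -> nat -> scalar_field R k)
    (m : nat -> nat) :
  (forall (m : nat -> nat) x B, (forall i, (i < M)%N -> (m i <= m i.+1)%N) ->
      (forall i, (i < M)%N -> \sum_(m i <= j < m i.+1) x j = 0) ->
      (forall i, (i < M)%N -> W (m i) (m i.+1) x <= B) ->
      W (m 0%N) (m M) x <= eps * M%:R * B) ->
  (forall i, (i < M)%N -> step_ok h eta L (x i) (m i) (m i.+1)) ->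
  forall b, W 0 b (\sum_(i < M) x i) <=
    M%:R * (h + (1 + C) * eta + eps * (L + C * eta)).
Proof.
move=> Hblk ok b.
have mlt i : (i < M)%N -> (m i < m i.+1)%N by move=> /ok[].
have mle := leq_steps (fun i iM => ltnW (mlt i iM)).
pose e i := \sum_(m i <= j < m i.+1) x i j.
pose D i := fun j => if j == m i then e i else 0.
pose B i := fun j => if (m i <= j < m i.+1)%N then x i j - D i j else 0.
have WD i : (i < M)%N -> W (m i) (m i.+1) (D i) <= C * eta.
  move=> iM; rewrite (le_trans (inorm_le_sum IW _ _ _))//.
  rewrite ler_wpM2l ?(inorm_const_ge0 IW)// big_ltn ?mlt//.
  rewrite big_nat big1 => [|j /andP[ij _]].
    by rewrite addr0 /D eqxx; case: (ok i iM).
  by rewrite /D gtn_eqF// modulus0.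
have WA i : (i < M)%N -> W 0 b (x i - B i) <= h + (1 + C) * eta.
  move=> iM; have [_ x1 x2 _ _] := ok _ iM.
  pose b' := maxn b (m i.+1).
  have bb' : (b <= b')%N by rewrite leq_maxl.
  have mb' : (m i.+1 <= b')%N by rewrite leq_maxr.
  apply: le_trans (inorm_mono IW _ (leqnn _) (leq0n _) bb') _.
  apply: le_trans (inorm_cat IW _ (leq0n (m i)) (leq_trans (ltnW (mlt _ iM)) mb')) _.
  rewrite lerD//.
    apply: le_trans x1; apply: inorm_le_ext => j /andP[_ jm]; rewrite !fctE /B.
    by rewrite leqNgt jm/= subr0.
  apply: le_trans (inorm_cat IW _ (ltnW (mlt _ iM)) mb') _.
  rewrite addrC mulrDl mul1r lerD//.
    apply: le_trans (x2 _ mb'); apply: inorm_le_ext => j /andP[jm _]; rewrite !fctE /B.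
    by rewrite [(j < _)%N]ltnNge jm/= andbF subr0.
  apply: le_trans (WD _ iM); apply: inorm_le_ext => j jm; rewrite !fctE /B jm.
  by rewrite opprB addrC subrK.
have Bi i j : (i < M)%N -> (m i <= j < m i.+1)%N ->
    (\sum_(i < M) B i) j = x i j - D i j.
  move=> iM jm; rewrite fct_sumE (bigD1 (Ordinal iM))//= big1 ?addr0; first by rewrite /B jm.
  move=> i' ii'; rewrite /B; case: ifP => // jm'.
  have := ltn_ord i'; have := mle i.+1 i'; have := mle i'.+1 i => h1 h2 i'M.
  exfalso; move: ii'; rewrite -val_eqE/= neq_ltn => /orP[/h1|/h2]; lia.
have WB : W (m 0%N) (m M) (\sum_(i < M) B i) <= eps * M%:R * (L + C * eta).
  apply: Hblk => [i /mlt /ltnW //|i iM|i iM].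
    rewrite big_nat (eq_bigr (fun j => x i j - D i j)) => [|j]; last exact: Bi.
    rewrite -big_nat sumrB [X in _ - X]big_ltn ?mlt//.
    rewrite [X in _ - (_ + X)]big_nat [X in _ - (_ + X)]big1 => [|j /andP[ij _]].
      by rewrite addr0 /D eqxx subrr.
    by rewrite /D gtn_eqF.
  apply: (@le_trans _ _ (W (m i) (m i.+1) (x i - D i))).
    by apply: inorm_le_ext => j /(Bi _ _ iM) ->.
  rewrite (le_trans (inormB _ _ _ _))// lerD ?WD//.
  have [_ _ _ _ /(_ (m i.+1))] := ok _ iM; apply: le_trans.
  by apply: (inorm_mono IW) => //; rewrite ltnW ?mlt.
have WB' : W 0 b (\sum_(i < M) B i) <= eps * M%:R * (L + C * eta).
  pose b' := maxn b (m M).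
  have bb' : (b <= b')%N by rewrite leq_maxl.
  have mb' : (m M <= b')%N by rewrite leq_maxr.
  apply: le_trans (inorm_mono IW _ (leqnn _) (leq0n _) bb') _.
  have m0M := mle _ _ (leq0n M) (leqnn M).
  apply: le_trans (inorm_cat IW _ (leq0n (m 0%N)) (leq_trans m0M mb')) _.
  rewrite inorm0 ?add0r => [|j jm]; last first.
    rewrite fct_sumE big1// => i _; rewrite /B; case: ifP => //.
    by have := mle 0%N i (leq0n _) (ltnW (ltn_ord i)); lia.
  apply: le_trans (inorm_cat IW _ m0M mb') _.
  rewrite [X in _ + X]inorm0 ?addr0// => j jm.
  rewrite fct_sumE big1// => i _; rewrite /B; case: ifP => //.
  by have := mle i.+1 M (ltn_ord i) (leqnn _); lia.
have -> : \sum_(i < M) x i = \sum_(i < M) (x i - B i) + \sum_(i < M) B i.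
  by rewrite -big_split/=; apply: eq_bigr => i _; rewrite subrK.
rewrite (le_trans (inormD IW _ _ _ _))// mulrDr lerD//; last first.
  by rewrite (le_trans WB')// mulrA [M%:R * _]mulrC.
rewrite (le_trans (inorm_sum _ _ _ _ _))//.
rewrite (le_trans (ler_sum _ (fun (i : 'I_M) _ => WA i (ltn_ord i))))//.
by rewrite sumr_const card_ord mulr_natl.
Qed.

End IntervalNorm.

(** * Trees in sequence spaces with an interval norm *)

Lemma hyperbolic_dist_cat s t : hyperbolic_dist s (s ++ t) = size t.
Proof.
rewrite /hyperbolic_dist size_cat; suff -> : ancestor s (s ++ t) = s by lia.
by elim: s => //= x s ->; rewrite eqxx.
Qed.

Lemma hyperbolic_dist_fork s i j t u : i != j ->
  hyperbolic_dist (s ++ i :: t) (s ++ j :: u) = (size t + size u).+2.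
Proof.
move=> ij; rewrite /hyperbolic_dist !size_cat.
suff -> : ancestor (s ++ i :: t) (s ++ j :: u) = s by rewrite /=; lia.
by elim: s => /= [|x s ->]; rewrite ?eqxx// (negPf ij).
Qed.

Section TreeObstruction.
Variables (R : realType) (k : scalar_kind).
Variables (W : nat -> nat -> (nat -> scalar_field R k) -> R) (C : R).
Hypothesis IW : interval_norm W C.
Variables (alpha beta : R) (N : nat) (F : seq nat -> nat -> scalar_field R k).
Hypotheses (alpha0 : 0 < alpha) (beta0 : 0 < beta).
Hypothesis F_le : forall s t, (size s <= N)%N -> (size t <= N)%N ->
  forall b, W 0 b (F s - F t) <= beta * (hyperbolic_dist s t)%:R.
Hypothesis F_ge : forall s t, (size s <= N)%N -> (size t <= N)%N ->
  forall B, (forall b, W 0 b (F s - F t) <= B) ->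
  alpha * (hyperbolic_dist s t)%:R <= B.
Variables (U : set_system nat) (UU : UltraFilter U).
Hypothesis U_gt : forall n, U [set i | (n < i)%N]%classic.

Let U2 : UltraFilter (fubini U U) := fubini_ultra UU UU.
Let P n := upow (fubini U U) n.
(* G compares two interlaced branches, and D w v is the increment of G when the
   word of pairs w is prolonged by v. *)
Let G (w : seq (nat * nat)) := F (unzip1 w) - F (unzip2 w).
Let D w v := G (w ++ v) - G w.

Let incr_le s t b : (size s + size t <= N)%N ->
  W 0 b (F (s ++ t) - F s) <= beta * (size t)%:R.
Proof.
move=> st; rewrite -(hyperbolic_dist_cat s t) hyperbolic_distC F_le ?size_cat//.
by rewrite (leq_trans _ st)// leq_addr.
Qed.

Let DE w v : D w v = (F (unzip1 w ++ unzip1 v) - F (unzip1 w)) -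
  (F (unzip2 w ++ unzip2 v) - F (unzip2 w)).
Proof.
by rewrite /D /G /unzip1 /unzip2 !map_cat !opprD !opprK addrACA.
Qed.

Let D_le w v b : (size w + size v <= N)%N -> W 0 b (D w v) <= 2 * beta * (size v)%:R.
Proof.
move=> wv; rewrite DE (le_trans (inormB IW _ _ _ _))//.
rewrite mulr_natl mulr2n mulrDl lerD// -?[X in _ * X%:R](size_map fst) -?[X in _ * X%:R](size_map snd).
  by rewrite -/(unzip1 v) incr_le// !size_map.
rewrite [X in _ * X%:R](size_map fst) -[X in _ * X%:R](size_map snd).
by rewrite -/(unzip2 v) incr_le// !size_map.
Qed.

(** The sum over [m, m') of the increment of F is a bounded function of
    (w, m, v, m'), so it has a limit c along the iterated ultrafilter. Both
    branches of the pair give the same c, which cancels in D. *)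
Let typ_block_sum n l eta : (n + l <= N)%N -> 0 < eta ->
  P n [set w | U [set m | P l [set v | U [set m' |
    modulus (\sum_(m <= j < m') D w v j) <= eta]]]]%classic.
Proof.
move=> nlN eta0.
pose V := fubini (fubini (fubini (upow U n) U) (upow U l)) U.
pose g (q : (seq nat * nat) * seq nat * nat) :=
  \sum_(q.1.1.2 <= j < q.2) (F (q.1.1.1 ++ q.1.2) - F q.1.1.1) j.
have [|c gc] := @scalar_ultra_limit R _ V _ k g (C * (beta * l%:R)).
  rewrite /V /fubini/=.
  apply: filterS (upow_size n UU) => s /= sn; apply: filterE => m.
  apply: filterS (upow_size l UU) => t /= tl; apply: filterE => m'.
  rewrite /g /=; have [m'm|mm'] := leqP m' m.
    rewrite big_geq// modulus0 mulr_ge0 ?(inorm_const_ge0 IW)//.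
    by rewrite mulr_ge0// ltW.
  rewrite (le_trans (sum_le_inorm IW _ _ _))// ler_wpM2l ?(inorm_const_ge0 IW)//.
  have := @incr_le s t m'; rewrite sn tl => /(_ nlN); apply: le_trans.
  by rewrite (inorm_mono IW)// ltnW.
have eta2 : 0 < eta / 2 by rewrite divr_gt0.
have {}gc : upow U n [set s | U [set m | upow U l [set t | U [set m' |
    modulus (g (s, m, t, m') - c) < eta / 2]]]]%classic by exact: gc.
apply: filterS2 (upow_unzip1 UU gc) (upow_unzip2 UU gc) => w /= h1 h2.
apply: filterS2 h1 h2 => m /= h1 h2.
apply: filterS2 (upow_unzip1 UU h1) (upow_unzip2 UU h2) => v /= {}h1 {}h2.
apply: filterS2 h1 h2 => m' /= h1 h2.
have -> : \sum_(m <= j < m') D w v j =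
    (g (unzip1 w, m, unzip1 v, m') - c) - (g (unzip2 w, m, unzip2 v, m') - c).
  by rewrite opprB addrA subrK /g/= -sumrB; apply: eq_bigr => j _; rewrite DE.
rewrite (le_trans (modulusD _ _))// [leRHS]splitr lerD// ?(ltW h1)//.
by rewrite modulusN; exact: ltW.
Qed.

(** The two words have distinct first letters in their first components and
    share their second components, so the difference of the corresponding
    increments of G is a difference of two values of F. *)
Let typ_fork l (A : set (seq (nat * nat))) : P l.+1 A ->
  exists i i' z u v, [/\ i != i', A ((i, z) :: u), A ((i', z) :: v) &
    unzip2 u = unzip2 v].
Proof.
move=> PA; have [i Ai] := @filter_ex _ U _ _ PA.
have [i' [Ai' ii']] := @filter_ex _ U _ _ (@filterI _ U _ _ _ PA (U_gt i)).
have [z [zA zA']] := filter_ex (filterI Ai Ai').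
have [u [v [Au Av uv]]] := upow_same_unzip2 UU zA zA'.
by exists i, i', z, u, v; split => //; rewrite neq_ltn ii'.
Qed.

(** If the tails were typically small, two words as in [typ_fork] would give
    increments that almost agree before m, by convergence of finitely many
    coordinates, and are both small after m, although the two values of F are
    2 alpha l apart. *)
Let typ_tail w l m : (size w + l <= N)%N -> (0 < l)%N ->
  P l [set v | exists2 b, (m <= b)%N & alpha / 2 * l%:R < W m b (D w v)]%classic.
Proof.
case: l => // l wlN _.
have PU : UltraFilter (P l.+1) by exact: upow_ultra.
case: (in_ultra_setVsetC [set v | exists2 b, (m <= b)%N &
    alpha / 2 * l.+1%:R < W m b (D w v)]%classic PU) => // small.
(* Chosen so that the contribution 2 C m eta of the m coordinates of the head is
   less than alpha * l.+1; the summand 1 keeps the denominator positive. *)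
pose eta := alpha * l.+1%:R / (C * m%:R * 2 + 1) / 2.
have Cm0 : 0 <= C * m%:R * 2.
  by rewrite !mulr_ge0 ?(inorm_const_ge0 IW).
have eta0 : 0 < eta.
  by rewrite /eta divr_gt0// divr_gt0 ?mulr_gt0// ltr_wpDl.
have [y Py] : exists y : nat -> scalar_field R k,
    P l.+1 [set v | forall j, (j < m)%N -> modulus (D w v j - y j) < eta]%classic.
  have [|y yP] := @choice _ _ (fun j c =>
      P l.+1 [set v | modulus (D w v j - c) < eta]%classic).
    move=> j; have [|c cP] := @scalar_ultra_limit R _ (P l.+1) _ k
        (fun v => D w v j) (C * (2 * beta * l.+1%:R)); last by exists c; exact: cP.
    apply: filterS (upow_size l.+1 U2) => v /= vl.
    have -> : D w v j = \sum_(j <= i < j.+1) D w v i by rewrite big_nat1.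
    rewrite (le_trans (sum_le_inorm IW _ _ _))// ler_wpM2l ?(inorm_const_ge0 IW)//.
    have := @D_le w v j.+1; rewrite vl => /(_ wlN); apply: le_trans.
    by rewrite (inorm_mono IW)// ltnW.
  exists y; elim: (m) => [|m' IH]; first by apply: filterE.
  apply: filterS2 IH (yP m') => v /= IH ym' j.
  by rewrite ltnS leq_eqVlt => /orP[/eqP->//|/IH].
have PF : Filter (P l.+1) by exact: filter_filter.
have small_at_y := @filterI _ _ PF _ _ (@filterI _ _ PF _ _ small Py) (upow_size l.+1 U2).
have [i [i' [z [u [v [ii' [[uS uy] us] [[vS vy] vs] uv]]]]]] := typ_fork small_at_y.
move: us vs => /= [us] [vs].
have DD : D w ((i, z) :: u) - D w ((i', z) :: v) =
    F (unzip1 w ++ i :: unzip1 u) - F (unzip1 w ++ i' :: unzip1 v).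
  have cancel (Z : zmodType) (a b c d : Z) : a - c - d - (b - c - d) = a - b.
    by rewrite opprB addrA subrK opprB addrA subrK.
  by rewrite !DE /= uv cancel.
have : alpha * (hyperbolic_dist (unzip1 w ++ i :: unzip1 u) (unzip1 w ++ i' :: unzip1 v))%:R <=
    C * (eta * 2 * m%:R) + alpha * l.+1%:R.
  apply: F_ge; rewrite ?size_cat/= ?size_map ?us ?vs// => b.
  rewrite -DD; pose b' := maxn b m.
  have bb' : (b <= b')%N by rewrite leq_maxl.
  have mb' : (m <= b')%N by rewrite leq_maxr.
  apply: le_trans (inorm_mono IW _ (leqnn _) (leq0n _) bb') _.
  apply: le_trans (inorm_cat IW _ (leq0n _) mb') _.
  apply: lerD.
    rewrite (le_trans (inorm_le_sum IW _ _ _))// ler_wpM2l ?(inorm_const_ge0 IW)//.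
    rewrite mulr_natr -[X in _ *+ X]subn0 -(sumr_const_nat m 0) big_nat [leRHS]big_nat.
    apply: ler_sum => j /andP[_ jm].
    have -> : (D w ((i, z) :: u) - D w ((i', z) :: v)) j =
      (D w ((i, z) :: u) j - y j) - (D w ((i', z) :: v) j - y j).
      by rewrite [in RHS]opprB [in RHS]addrA [in RHS]subrK.
    rewrite (le_trans (modulusD _ _))// mulr_natr mulr2n lerD// ?(ltW (uy _ jm))//.
    by rewrite modulusN; exact: ltW (vy _ jm).
  rewrite (le_trans (inormB IW _ _ _ _))// [alpha]splitr mulrDl lerD// leNgt.
    by apply/negP => h; apply: uS; exists b'.
  by apply/negP => h; apply: vS; exists b'.
rewrite hyperbolic_dist_fork// !size_map us vs leNgt => /negP[].
have -> : alpha * (l + l).+2%:R = alpha * l.+1%:R + alpha * l.+1%:R.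
  by rewrite -mulrDr -natrD addSn addnS.
rewrite ltrD2r.
have -> : C * (eta * 2 * m%:R) = alpha * l.+1%:R * (C * m%:R / (C * m%:R * 2 + 1)).
  by rewrite /eta; field; rewrite gt_eqF// ltr_wpDl.
rewrite gtr_pMr ?mulr_gt0// ltr_pdivrMr ?ltr_wpDl// mul1r.
by rewrite ltr_pwDr// ler_peMr// ?ler1n// mulr_ge0 ?(inorm_const_ge0 IW).
Qed.

(* L is a Lipschitz constant of G at scale l along typical words, starting from
   any level. *)
Let typ_le l (L : R) := forall n, (n + l <= N)%N ->
  P n [set w | P l [set v | forall b, W 0 b (D w v) <= L * l%:R]]%classic.

Let typ_le1 : typ_le 1 (2 * beta).
Proof.
move=> n nN; apply: filterS (upow_size n U2) => w wn.
apply: filterS (upow_size 1 U2) => v v1 b.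
by have := @D_le w v b; rewrite wn v1; apply.
Qed.

(** By [typ_tail] the tail has a fixed proportion kap of the increment, whose
    head is then controlled by convexity. *)
Let typ_step_ok l (L kap theta eta : R) n :
  (forall a b c x B, (a <= b)%N -> (b <= c)%N -> W a c x <= B ->
     kap * B <= W b c x -> W a b x <= theta * B) ->
  kap * L <= alpha / 2 -> 0 < eta ->
  typ_le l L -> (0 < l)%N -> (n + l <= N)%N ->
  P n [set w | U [set m | P l [set v | U [set m' |
    step_ok W (theta * (L * l%:R)) eta (L * l%:R) (D w v) m m']]]]%classic.
Proof.
move=> Htheta kapL eta0 Ll l0 nlN; have nsz := upow_size n U2.
apply: filterS3 nsz (Ll _ nlN) (typ_block_sum nlN eta0) => w wn leD sumD.
apply: filterS sumD => m sumD.
have wlN : (size w + l <= N)%N by rewrite wn.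
apply: filterS3 leD (typ_tail m wlN l0) sumD => v leD [b mb tailD] sumD.
have [m0 Hm0] := inorm_tail IW leD eta0.
apply: filterS3 sumD (U_gt m) (U_gt m0) => m' sumD mm' m0m'; split=> //.
  apply: (Htheta 0%N m b) => //; rewrite (le_trans _ (ltW tailD))// mulrA.
  by rewrite ler_wpM2r.
by move=> c; apply: Hm0; exact: ltnW.
Qed.

Let chain (h eta B : R) i z m := exists (x : nat -> nat -> scalar_field R k) (mm : nat -> nat),
  [/\ mm i = m, z = \sum_(j < i) x j &
    forall j, (j < i)%N -> step_ok W h eta B (x j) (mm j) (mm j.+1)].

(** The breakpoint following a block is chosen after the letters of this block
    and before those of the next one. *)
Let typ_chain l (h eta B : R) n i :
  (forall n, (n + l <= N)%N -> P n [set w | U [set m | P l [set v | U [set m' |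
    step_ok W h eta B (D w v) m m']]]]%classic) ->
  (n + i * l <= N)%N ->
  P n [set w | P (i * l)%N [set v | U [set m | chain h eta B i (D w v) m]]]%classic.
Proof.
move=> ok; elim: i => [|i IH] niN.
  apply: filterE => w; rewrite mul0n.
  change (U [set m | chain h eta B 0 (D w [::]) m]%classic).
  apply: filterE => m.
  exists (fun _ => 0), (fun _ => m); split => //.
  by rewrite big_ord0 /D cats0 subrr.
have [n1 n2] : (n + i * l <= N)%N /\ (n + i * l + l <= N)%N by move: niN; rewrite mulSnr; lia.
have ok1 := ok _ n2; rewrite /P upow_cat in ok1.
apply: filterS2 (IH n1) ok1 => w /= {}IH {}ok1.
rewrite mulSnr /P upow_cat; apply: filterS2 IH ok1 => v IH ok1.
(* One breakpoint m that suits both the chain so far and the next block is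
   enough: the longer chain is quantified over its last breakpoint m' only. *)
have [m [[x [mm [mmi Dv xok]]] okm]] := @filter_ex _ U _ _ (filterI IH ok1).
apply: filterS okm => u; apply: filterS => m' okm'.
exists (fun j => if j == i then D (w ++ v) u else x j).
exists (fun j => if j == i.+1 then m' else mm j); split.
- by rewrite eqxx.
- rewrite big_ord_recr/= eqxx (eq_bigr (fun j : 'I_i => x j)) => [|j _]; last first.
    by rewrite ltn_eqF.
  by rewrite -Dv /D catA addrC addrA subrK.
- move=> j; rewrite ltnS leq_eqVlt => /orP[/eqP->|ji].
    by rewrite !eqxx ltn_eqF// mmi.
  by rewrite eqSS (ltn_eqF ji) (ltn_eqF (ltn_trans ji (ltnSn i))); exact: xok.
Qed.

Variables (kap theta : R) (M : nat).
Hypotheses (kap0 : 0 < kap) (theta01 : 0 <= theta < 1).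
Hypothesis kapb : kap * (2 * beta) <= alpha / 2.
Hypothesis Htheta : forall a b c x B, (a <= b)%N -> (b <= c)%N ->
  W a c x <= B -> kap * B <= W b c x -> W a b x <= theta * B.
Hypothesis HM : forall (m : nat -> nat) x B,
  (forall i, (i < M)%N -> (m i <= m i.+1)%N) ->
  (forall i, (i < M)%N -> \sum_(m i <= j < m i.+1) x j = 0) ->
  (forall i, (i < M)%N -> W (m i) (m i.+1) x <= B) ->
  W (m 0%N) (m M) x <= (1 - theta) / 8 * M%:R * B.

(** The loss factor theta of the heads leaves a gap 1 - theta. The blocks use
    an eighth of it, by the choice of M, and the errors about as much, by the
    choice of eta; less than half of it is lost. *)
Let typ_improve l L : (0 < l)%N -> 0 < L <= 2 * beta ->
  typ_le l L -> typ_le (M * l) ((1 + theta) / 2 * L).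
Proof.
have /andP[theta0 theta1] := theta01.
move=> l0 /andP[L0 Lb] Ll.
have d0 : 0 < (1 - theta) / 8 by rewrite divr_gt0// subr_gt0.
have C0 := inorm_const_ge0 IW.
have Ll0 : 0 < L * l%:R by rewrite mulr_gt0// ltr0n.
pose eta := (1 - theta) / 8 / (1 + C) * (L * l%:R).
have C10 : 0 < 1 + C by rewrite ltr_pwDl.
have eta0 : 0 < eta by rewrite /eta mulr_gt0// divr_gt0.
have ok m : (m + l <= N)%N -> P m [set w | U [set m | P l [set v | U [set m' |
    step_ok W (theta * (L * l%:R)) eta (L * l%:R) (D w v) m m']]]]%classic.
  apply: (@typ_step_ok _ _ kap) => //; rewrite (le_trans _ kapb)//.
  by rewrite ler_wpM2l// ltW.
move=> n nN; apply: filterS (typ_chain ok nN) => w; apply: filterS => v.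
move=> /(@filter_ex _ U)[_ [x [mm [_ Dx xok]]]] b; rewrite Dx.
apply: le_trans (inorm_steps IW HM xok b) _.
have -> : (1 + theta) / 2 * L * (M * l)%:R = M%:R * ((1 + theta) / 2 * (L * l%:R)).
  by rewrite natrM; ring.
rewrite ler_wpM2l//.
have e1 : (1 + C) * eta = (1 - theta) / 8 * (L * l%:R).
  by rewrite /eta; field; rewrite gt_eqF.
have : C * eta <= (1 + C) * eta by rewrite ler_wpM2r ?(ltW eta0)// lerDr.
rewrite e1; set Q := L * l%:R in Ll0 *; set E := C * eta => EQ.
have : (1 - theta) / 8 * E <= (1 - theta) / 8 * Q.
  by rewrite ler_wpM2l ?(ltW d0)// (le_trans EQ)// ger_pMl//; lra.
nra.
Qed.

(** After K improvements the whole height is a single step of the largest scale;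
    there G is at least 2 alpha N on two branches with distinct first
    letters. *)
Lemma tree_scale_bound K : (0 < M)%N -> N = (M ^ K)%N ->
  alpha <= beta * ((1 + theta) / 2) ^+ K.
Proof.
have /andP[theta0 theta1] := theta01.
move=> M0 NK; set q := (1 + theta) / 2.
have q0 : 0 < q by rewrite divr_gt0// ltr_pwDl.
have q1 : q <= 1 by rewrite /q; lra.
have scale j : typ_le (M ^ j) (2 * beta * q ^+ j).
  elim: j => [|j IH]; first by rewrite expr0 mulr1; exact: typ_le1.
  rewrite expnS exprS [2 * beta * _]mulrCA; apply: typ_improve => //.
    by rewrite expn_gt0 M0.
  rewrite !mulr_gt0 ?exprn_gt0//= ler_piMr ?mulr_ge0// ?(ltW beta0)//.
  by rewrite exprn_ile1// ltW.
have N_pos : (0 < N)%N by rewrite NK expn_gt0 M0.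
have := scale K 0%N; rewrite -NK add0n => /(_ (leqnn _)) top.
have {}top : P N [set v | forall b, W 0 b (D [::] v) <= 2 * beta * q ^+ K * N%:R]%classic.
  exact: top.
have PN : Filter (P N) by exact: filter_filter.
have {PN}top := @filterI _ _ PN _ _ top (upow_size N U2).
have [x [y [v [xy vN leD]]]] : exists x y v, [/\ (x < y)%N, size ((x, y) :: v) = N &
    forall b, W 0 b (D [::] ((x, y) :: v)) <= 2 * beta * q ^+ K * N%:R].
  move: N_pos (2 * beta * q ^+ K * N%:R) top; case: (N) => // N' _ B top.
  have [x Ax] := @filter_ex _ U _ _ top.
  have [y [Ay xy]] := @filter_ex _ U _ _ (@filterI _ U _ _ _ Ax (U_gt x)).
  by have [v [? ?]] := filter_ex Ay; exists x, y, v.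
have DF : D [::] ((x, y) :: v) = F (x :: unzip1 v) - F (y :: unzip2 v).
  by rewrite /D /G /= subrr subr0.
have vN' : (size v).+1 = N by [].
have := @F_ge (x :: unzip1 v) (y :: unzip2 v).
rewrite [size (x :: _)]/= [size (y :: _)]/= !size_map vN'.
move=> /(_ (leqnn _) (leqnn _) (2 * beta * q ^+ K * N%:R)).
rewrite -DF => /(_ leD).
rewrite (@hyperbolic_dist_fork [::])//; last by rewrite ltn_eqF.
rewrite !size_map.
have -> : (size v + size v).+2 = (2 * N)%N by rewrite -vN /=; lia.
rewrite natrM mulrA ler_pM2r ?ltr0n// -!mulrA [alpha * _]mulrC ler_pM2l//.
Qed.

End TreeObstruction.

Theorem tree_obstruction (R : realType) (k : scalar_kind)
    (W : nat -> nat -> (nat -> scalar_field R k) -> R) (C alpha beta : R) :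
  interval_norm W C -> 0 < alpha -> 0 < beta ->
  ~ forall N, (0 < N)%N -> exists F : seq nat -> nat -> scalar_field R k,
    (forall s t, (size s <= N)%N -> (size t <= N)%N ->
      forall b, W 0 b (F s - F t) <= beta * (hyperbolic_dist s t)%:R) /\
    (forall s t, (size s <= N)%N -> (size t <= N)%N ->
      forall B, (forall b, W 0 b (F s - F t) <= B) ->
      alpha * (hyperbolic_dist s t)%:R <= B).
Proof.
move=> IW alpha0 beta0 embeds.
(* A tail of norm alpha * l / 2 in an increment of norm at most 2 * beta * l. *)
pose kap := alpha / (4 * (alpha + beta)).
have ab0 : 0 < 4 * (alpha + beta) by rewrite mulr_gt0// addr_gt0.
have kap0 : 0 < kap by rewrite divr_gt0.
have kap1 : kap <= 1 by rewrite ler_pdivrMr// mul1r; lra.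
have kapb : kap * (2 * beta) <= alpha / 2.
  by rewrite /kap mulrAC ler_pdivrMr//; nra.
have [|theta theta01 Htheta] := @inorm_convex _ _ _ _ IW kap; first by rewrite kap0.
have /andP[theta0 theta1] := theta01.
have d0 : 0 < (1 - theta) / 8 by rewrite divr_gt0// subr_gt0.
have [M M0 HM] := @inorm_blocks _ _ _ _ IW _ d0.
pose q := (1 + theta) / 2.
have [K qK] : exists K, beta * q ^+ K < alpha.
  have q1 : `|q| < 1 by rewrite ger0_norm /q; lra.
  have /cvgrPdist_lt := cvg_expr q1 => /(_ (alpha / beta) (divr_gt0 alpha0 beta0)).
  move=> [K _ /(_ K (leqnn K))] /=; rewrite sub0r normrN ltr_pdivlMr// mulrC => qK.
  by exists K; rewrite (le_lt_trans _ qK)// ler_pM2l// ler_norm.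
have N0 : (0 < M ^ K)%N by rewrite expn_gt0 M0.
have [F [F_le F_ge]] := embeds _ N0.
have [U UU U_gt] := nonprincipal_ultrafilter.
have := tree_scale_bound IW alpha0 beta0 F_le F_ge UU U_gt kap0 theta01 kapb Htheta HM M0 erefl.
by rewrite leNgt qK.
Qed.

(** * Sums of p-th powers along increasing lists *)

Section VariationSums.
Variables (R : realType) (k : scalar_kind) (p : R) (p1 : 1 < p).
Implicit Types (x y z : nat -> scalar_field R k) (s t : seq nat).

Let p0 : 0 < p. Proof. exact: lt_trans p1. Qed.
Let pN0 : p != 0. Proof. by rewrite gt_eqF. Qed.

Lemma ler_powR_exp (a b : R) : 0 <= a -> a <= b -> a `^ p <= b `^ p.
Proof.
by move=> a0 ab; apply: ge0_ler_powR; rewrite ?nnegrE ?(ltW p0)// (le_trans a0).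
Qed.

Lemma variation_sum1 x u : variation_sum p x [:: u] = 0.
Proof. by rewrite /variation_sum big_geq. Qed.

Lemma variation_sum_cons x u v s : variation_sum p x (u :: v :: s) =
  modulus (x v - x u) `^ p + variation_sum p x (v :: s).
Proof. by rewrite /variation_sum/= big_nat_recl. Qed.

Lemma variation_sum_cat x u s v t :
  variation_sum p x (u :: s) + variation_sum p x (v :: t) <=
  variation_sum p x (u :: s ++ v :: t).
Proof.
elim: s u => [|w s IH] u.
  by rewrite cat0s variation_sum1 add0r variation_sum_cons lerDr powR_ge0.
by rewrite cat_cons !variation_sum_cons -addrA lerD2l.
Qed.

Lemma variation_sum_le_map x y (f : nat -> nat) s :
  (forall u v, modulus (x v - x u) <= modulus (y (f v) - y (f u))) ->
  variation_sum p x s <= variation_sum p y (map f s).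
Proof.
move=> xy; case: s => [|u s]; first by rewrite /variation_sum !big_geq.
elim: s u => [|v s IH] u; first by rewrite !variation_sum1.
rewrite map_cons map_cons !variation_sum_cons lerD ?(IH v)//.
exact: ler_powR_exp (modulus_ge0 _) (xy _ _).
Qed.

Lemma eq_variation_sum x y s :
  {in s &, forall u v, modulus (x v - x u) = modulus (y v - y u)} ->
  variation_sum p x s = variation_sum p y s.
Proof.
case: s => [|u s]; first by rewrite /variation_sum !big_geq.
elim: s u => [|v s IH] u xy; first by rewrite !variation_sum1.
rewrite !variation_sum_cons (IH v) => [|a b aS bS].
  by rewrite (xy u v) ?in_cons ?eqxx ?orbT.
by apply: xy; rewrite in_cons ?aS ?bS orbT.
Qed.

(** Images of increasing lists under nondecreasing maps may have repetitions,
    and these contribute 0. *)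
Lemma variation_sum_weak_le x s : (0 < size s)%N -> sorted leq s ->
  ((variation_sum p x s)%:E <= variation p x)%E.
Proof.
case: s => // u s _; rewrite [sorted _ _]/= => us.
suff [s' us' <-] : exists2 s', path ltn u s' &
    variation_sum p x (u :: s') = variation_sum p x (u :: s).
  exact: variation_sum_le.
elim: s u us => [|v s IH] u; first by exists [::].
move=> /andP[uv /IH[s' us' E]]; move: uv; rewrite leq_eqVlt => /orP[/eqP uv|uv].
  exists s'; rewrite ?uv// E variation_sum_cons subrr modulus0 powR0// add0r.
  by [].
by exists (v :: s'); rewrite /= ?uv// !variation_sum_cons E.
Qed.

Lemma variation_le x (B : R) :
  (forall s, (0 < size s)%N -> sorted ltn s -> variation_sum p x s <= B) ->
  (variation p x <= B%:E)%E.
Proof. by move=> xB; apply: ge_ereal_sup => _ [s [s0 ss] <-]; rewrite lee_fin xB. Qed.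

Lemma sorted_leq_map (f : nat -> nat) s :
  {homo f : m n / (m <= n)%N} -> sorted ltn s -> sorted leq (map f s).
Proof.
move=> fle ss; rewrite sorted_map; apply: sub_sorted ss => u v /ltnW.
exact: fle.
Qed.

Lemma variation_le_map x y (f : nat -> nat) : {homo f : m n / (m <= n)%N} ->
  (forall u v, modulus (x v - x u) <= modulus (y (f v) - y (f u))) ->
  (variation p x <= variation p y)%E.
Proof.
move=> fle xy; apply: ge_ereal_sup => _ [s [s0 ss] <-].
apply: le_trans (@variation_sum_weak_le y (map f s) _ _).
- by rewrite lee_fin variation_sum_le_map.
- by rewrite size_map.
- exact: sorted_leq_map.
Qed.

Lemma variation_lty x (B : R) : (variation p x <= B%:E)%E -> (variation p x < +oo)%E.
Proof. by move=> xB; rewrite (le_lt_trans xB) ?ltry. Qed.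

Lemma variation_james_norm_le x (B : R) : (variation p x < +oo)%E -> 0 <= B ->
  james_norm p x <= B -> (variation p x <= (B `^ p)%:E)%E.
Proof.
move=> xfin B0 xB; rewrite -(james_normX p1)// lee_fin.
exact: ler_powR_exp (james_norm_ge0 _ _) xB.
Qed.

(** Lists for x and y are mapped to z and concatenated. The step that joins the
    two lists only increases the sum. *)
Lemma variation_superadditive x y z (f g : nat -> nat) :
  {homo f : m n / (m <= n)%N} -> {homo g : m n / (m <= n)%N} ->
  (forall m n, (f m <= g n)%N) ->
  (forall u v, modulus (x v - x u) <= modulus (z (f v) - z (f u))) ->
  (forall u v, modulus (y v - y u) <= modulus (z (g v) - z (g u))) ->
  (variation p z < +oo)%E ->
  james_norm p x `^ p + james_norm p y `^ p <= james_norm p z `^ p.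
Proof.
move=> fle gle fg xz yz zfin.
have xfin := le_lt_trans (variation_le_map fle xz) zfin.
have yfin := le_lt_trans (variation_le_map gle yz) zfin.
rewrite -lerBrDr -lee_fin (james_normX p1)//.
apply: variation_le => s s0 ss; rewrite lerBrDr addrC -lerBrDr -lee_fin (james_normX p1)//.
apply: variation_le => t t0 tt; rewrite lerBrDr addrC -lee_fin (james_normX p1)//.
apply: le_trans (@variation_sum_weak_le z (map f s ++ map g t) _ _).
- rewrite lee_fin; case: s s0 {ss} => // u s _; case: t t0 {tt} => // v t _.
  rewrite !map_cons cat_cons (le_trans _ (variation_sum_cat _ _ _ _ _))//.
  by rewrite lerD// -map_cons; exact: variation_sum_le_map.
- by rewrite size_cat size_map ltn_addr.
- have := sorted_leq_map fle ss; have := sorted_leq_map gle tt.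
  rewrite !(sorted_pairwise leq_trans) pairwise_cat => -> ->; rewrite !andbT.
  by apply/allrelP => _ _ /mapP[u _ ->] /mapP[v _ ->].
Qed.

(** At two given indices at most two of the x i are nonzero, so the increment of
    the sum is at most twice the increment of one of them. *)
Lemma variation_sum_disjoint (I : finType) (x : I -> nat -> scalar_field R k) s :
  (forall i j n, x i n != 0 -> x j n != 0 -> i = j) ->
  variation_sum p (fun n => \sum_i x i n) s <= 2 `^ p * \sum_i variation_sum p (x i) s.
Proof.
move=> xdis.
have xE n : (forall i, x i n = 0) \/ exists2 i, \sum_j x j n = x i n & forall j, j != i -> x j n = 0.
  case: (pickP (fun i => x i n != 0)) => [i xi|x0]; [right; exists i|left=> i].
  - rewrite (bigD1 i)//= big1 ?addr0// => j ji; apply/eqP; apply: contraR ji => xj.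
    by rewrite (xdis _ _ _ xj xi).
  - by move=> j ji; apply/eqP; apply: contraR ji => xj; rewrite (xdis _ _ _ xj xi).
  - by apply/eqP; have := x0 i; rewrite /= => /negbFE.
have key u v : (\sum_i x i v - \sum_i x i u = 0) \/
    exists i, modulus (\sum_i x i v - \sum_i x i u) <= 2 * modulus (x i v - x i u).
  have le2 c : modulus c <= 2 * modulus (c : scalar_field R k).
    by rewrite ler_peMl ?modulus_ge0// ler1n.
  have [v0|[i -> iv]] := xE v; have [u0|[j -> ju]] := xE u.
  - by left; rewrite !big1 ?subrr.
  - by right; exists j; rewrite v0 big1.
  - by right; exists i; rewrite u0 [X in _ - X]big1.
  - right; have [ij|ij] := eqVneq i j; first by exists i; rewrite {2}ij ij.
    have xiu : x i u = 0 by rewrite ju.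
    have xjv : x j v = 0 by rewrite iv// eq_sym.
    have h := modulusD (x i v) (- x j u); rewrite modulusN in h.
    have [vu|uv] := leP (modulus (x j u)) (modulus (x i v)).
      by exists i; rewrite xiu subr0 (le_trans h)// mulr_natl mulr2n lerD2l.
    exists j; rewrite xjv sub0r modulusN (le_trans h)// mulr_natl mulr2n lerD2r.
    exact: ltW.
rewrite /variation_sum exchange_big/= mulr_sumr; apply: ler_sum => n _.
set u := nth _ _ n; set v := nth _ _ n.+1.
have [->|[i le_i]] := key u v.
  by rewrite modulus0 powR0// mulr_ge0 ?powR_ge0// sumr_ge0// => i _; rewrite powR_ge0.
apply: le_trans (ler_powR_exp (modulus_ge0 _) le_i) _.
rewrite powRM ?modulus_ge0// ler_wpM2l ?powR_ge0//.
by rewrite (bigD1 i)//= lerDl sumr_ge0// => j _; rewrite powR_ge0.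
Qed.

Lemma variation_disjoint (I : finType) (x : I -> nat -> scalar_field R k) (B : I -> R) :
  (forall i j n, x i n != 0 -> x j n != 0 -> i = j) ->
  (forall i, (variation p (x i) <= (B i)%:E)%E) ->
  (variation p (fun n => (\sum_i x i n)%R) <= (2 `^ p * \sum_i B i)%R%:E)%E.
Proof.
move=> xdis xB; apply: variation_le => s s0 ss.
apply: le_trans (variation_sum_disjoint _ xdis) _.
rewrite ler_wpM2l ?powR_ge0//; apply: ler_sum => i _.
by rewrite -lee_fin (le_trans _ (xB i))// variation_sum_le.
Qed.

End VariationSums.

(** * The p-variation as an interval norm *)

Definition clip a b n := minn (maxn n a) b.

Lemma clip_homo a b : {homo clip a b : m n / (m <= n)%N}.
Proof. by move=> m n mn; rewrite /clip; lia. Qed.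

Section PartialSums.
Variables (R : realType) (k : scalar_kind).
Implicit Types (x y : nat -> scalar_field R k) (a b c n : nat).

(** The primitive of x that is constant outside of [a, b]: its variation only
    depends on the coordinates of x in [a, b). *)
Definition partial_sum a b x n := \sum_(a <= j < b | (j < n)%N) x j.

Lemma partial_sumE a b x n : (a <= b)%N ->
  partial_sum a b x n = \sum_(0 <= j < clip a b n) x j - \sum_(0 <= j < a) x j.
Proof.
move=> ab; have ac : (a <= clip a b n)%N by rewrite /clip; lia.
have cb : (clip a b n <= b)%N by rewrite /clip; lia.
rewrite (big_cat_nat (leq0n a) ac)/= addrAC subrr add0r.
rewrite /partial_sum (big_cat_nat ac cb)/=.
rewrite [X in _ + X]big_nat_cond [X in _ + X]big1 ?addr0; last by move=> j; rewrite /clip; lia.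
rewrite big_nat_cond [RHS]big_nat; apply: eq_bigl => j; rewrite /clip; lia.
Qed.

Lemma partial_sumD a b x y : partial_sum a b (x + y) = partial_sum a b x + partial_sum a b y.
Proof. by apply/funext => n; rewrite /partial_sum !fctE -big_split. Qed.

Lemma partial_sum_cat a b c x : (a <= b)%N -> (b <= c)%N ->
  partial_sum a c x = (partial_sum a b x \+ partial_sum b c x)%R.
Proof. by move=> ab bc; apply/funext => n; rewrite /partial_sum (big_cat_nat ab bc). Qed.

Lemma partial_sum_blocks (m : nat -> nat) M x :
  (forall i, (i < M)%N -> (m i <= m i.+1)%N) ->
  partial_sum (m 0%N) (m M) x = fun n => \sum_(i < M) partial_sum (m i) (m i.+1) x n.
Proof.
elim: M => [|M IH] mle.
  by apply/funext => n; rewrite big_ord0 /partial_sum big_geq.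
have m0M : (m 0%N <= m M)%N by apply: (leq_steps mle) => //; exact: leqnSn.
rewrite (partial_sum_cat x m0M (mle M (ltnSn _))) IH => [|i iM].
  by apply/funext => n; rewrite big_ord_recr.
by apply: mle; exact: ltnW.
Qed.

End PartialSums.

Section JamesIntervalNorm.
Variables (R : realType) (k : scalar_kind) (p : R) (p1 : 1 < p).
Implicit Types (x y z : nat -> scalar_field R k) (a b c n : nat).

Let p0 : 0 < p. Proof. exact: lt_trans p1. Qed.
Let pN0 : p != 0. Proof. by rewrite gt_eqF. Qed.

Definition james_inorm a b x := james_norm p (partial_sum a b x).

Lemma variation_step b :
  (variation p (fun n => if (b < n)%N then 1%R else 0%R : scalar_field R k) <= 1%:E)%E.
Proof.
apply: variation_le => -[//|u s] _ us.
suff : variation_sum p (fun n => if (b < n)%N then 1 else 0 : scalar_field R k) (u :: s) <=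
    1 - (b < u)%N%:R by move/le_trans; apply; rewrite gerBl.
elim: s u us => [|v s IH] u; first by rewrite variation_sum1; case: (b < u)%N; rewrite ?subrr ?subr0.
rewrite [sorted _ _]/= => /andP[uv vs]; rewrite variation_sum_cons.
have := IH v vs; case: (ltnP b v) => bv; case: (ltnP b u) => bu;
  rewrite ?subrr ?subr0 ?modulus0 ?modulus1 ?powR1 ?powR0//= ?add0r//; try lia.
by move=> h; rewrite -[leRHS]addr0 lerD2l.
Qed.

Lemma james_norm_cst0 : james_norm p (fun=> 0 : scalar_field R k) = 0.
Proof.
rewrite /james_norm variation_cst0//.
by rewrite (_ : fine _ = 0)// powR0// invr_eq0.
Qed.

(** The primitive is a combination of steps, and a step has norm 1. *)
Lemma partial_sum_bound a b x : (variation p (partial_sum a b x) < +oo)%E /\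
  james_inorm a b x <= \sum_(a <= j < b) modulus (x j).
Proof.
have vstep j := variation_step j.
have fstep j := variation_lty (vstep j).
have nstep j : james_norm p (fun n => if (j < n)%N then 1 else 0 : scalar_field R k) <= 1.
  by apply: (james_norm_le p1) => //; rewrite powR1.
have zero b' : (b' <= a)%N -> partial_sum a b' x = (fun=> 0).
  by move=> ba; apply/funext => n; rewrite /partial_sum big_geq.
rewrite /james_inorm; elim: b => [|b [fb nb]].
  by rewrite zero// variation_cst0// james_norm_cst0 big_geq.
have [ba|ab] := ltnP b a.
  by rewrite zero// variation_cst0// james_norm_cst0 big_geq.
have -> : partial_sum a b.+1 x =
    (partial_sum a b x \+ (fun n => x b * (if (b < n)%N then 1 else 0)))%R.
  apply/funext => n; rewrite /partial_sum big_mkcond big_nat_recr//= -big_mkcond.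
  by congr (_ + _); case: ifP; rewrite ?mulr1 ?mulr0.
have zfin : (variation p (fun n => (x b * (if (b < n)%N then 1 else 0))%R) < +oo)%E.
  by rewrite variationZ lte_mul_pinfty ?lee_fin ?powR_ge0.
split; first exact: variationD_lty.
rewrite big_nat_recr//= (le_trans (james_normD p1 fb zfin))// lerD//.
by rewrite james_normZ// ler_piMr ?modulus_ge0.
Qed.

Lemma variation_partial_sum a b x : (variation p (partial_sum a b x) < +oo)%E.
Proof. by case: (partial_sum_bound a b x). Qed.

Lemma james_inorm_superadditive a b c x : (a <= b)%N -> (b <= c)%N ->
  james_inorm a b x `^ p + james_inorm b c x `^ p <= james_inorm a c x `^ p.
Proof.
move=> ab bc; have ac := leq_trans ab bc.
apply: (@variation_superadditive _ _ _ p1 _ _ _ (clip a b) (clip b c)).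
- exact: clip_homo.
- exact: clip_homo.
- by move=> m n; rewrite /clip; lia.
- move=> u v; rewrite !partial_sumE//.
  have cc n : clip a c (clip a b n) = clip a b n by rewrite /clip; lia.
  by rewrite !cc !opprB !addrA !subrK.
- move=> u v; rewrite !partial_sumE//.
  have cc n : clip a c (clip b c n) = clip b c n by rewrite /clip; lia.
  by rewrite !cc !opprB !addrA !subrK.
- exact: variation_partial_sum.
Qed.

Lemma james_inorm_ge0 a b x : 0 <= james_inorm a b x.
Proof. exact: james_norm_ge0. Qed.

Lemma james_inorm_mono a' a b b' x :
  (a' <= a)%N -> (a <= b)%N -> (b <= b')%N -> james_inorm a b x <= james_inorm a' b' x.
Proof.
move=> a'a ab bb'; apply: (ler_powR_base p0 (james_inorm_ge0 _ _ _) (james_inorm_ge0 _ _ _)).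
apply: le_trans (james_inorm_superadditive x (leq_trans a'a ab) bb').
apply: ler_wpDr; first exact: powR_ge0.
apply: le_trans (james_inorm_superadditive x a'a ab).
by rewrite lerDr powR_ge0.
Qed.

(** Convexity comes from superadditivity of p-th powers. For the blocks, sum 0
    means that the primitives of the blocks vanish at both ends, hence have
    disjoint supports. *)
Lemma james_inorm_interval_norm : interval_norm james_inorm 1.
Proof.
split.
- exact: james_inorm_ge0.
- move=> a b x y; rewrite /james_inorm partial_sumD.
  by apply: (james_normD p1); exact: variation_partial_sum.
- move=> a b x; rewrite /james_inorm.
  rewrite (_ : partial_sum a b (- x) = fun n => - 1 * partial_sum a b x n).
    rewrite james_normZ ?variation_partial_sum// modulusN modulus1 mul1r.
    exact: lexx.
  by apply/funext => n; rewrite /partial_sum mulN1r -sumrN.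
- exact: ler01.
- by move=> a b x; rewrite mul1r; case: (partial_sum_bound a b x).
- move=> a b x; rewrite mul1r; have [ba|ab] := leqP b a.
    by rewrite big_geq// modulus0 james_inorm_ge0.
  have -> : \sum_(a <= j < b) x j = partial_sum a b x b - partial_sum a b x a.
    rewrite /partial_sum [X in _ - X]big_nat_cond [X in _ - X]big1 ?subr0; last by move=> j; lia.
    by rewrite big_nat [RHS]big_nat_cond; apply: eq_bigl => j; lia.
  exact: (modulus_le_james_norm p1 (variation_partial_sum _ _ _)).
- exact: james_inorm_mono.
- move=> a b c x ab bc; rewrite /james_inorm (partial_sum_cat x ab bc).
  by apply: (james_normD p1); exact: variation_partial_sum.
- move=> kap /andP[kap0 kap1].
  have kp0 : 0 < kap `^ p by rewrite powR_gt0.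
  have kp1 : kap `^ p <= 1.
    have -> : 1 = 1 `^ p :> R by rewrite powR1.
    exact: (ler_powR_exp p1 (ltW kap0) kap1).
  have d0 : 0 <= 1 - kap `^ p by rewrite subr_ge0.
  exists ((1 - kap `^ p) `^ p^-1).
    rewrite powR_ge0/=; have {2}-> : 1 = 1 `^ p^-1 :> R by rewrite powR1.
    apply: gt0_ltr_powR.
    + by rewrite invr_gt0.
    + by rewrite nnegrE.
    + by rewrite nnegrE.
    + by rewrite gtrBl.
  move=> a b c x N ab bc acN bcN.
  have N0 : 0 <= N := le_trans (james_inorm_ge0 _ _ _) acN.
  apply: (ler_powR_base p0 (james_inorm_ge0 _ _ _)).
    by rewrite mulr_ge0 ?powR_ge0.
  rewrite powRM ?powR_ge0// -powRrM mulVf// powRr1// mulrBl mul1r lerBrDr.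
  rewrite -powRM ?(ltW kap0)//.
  apply: (@le_trans _ _ (james_inorm a c x `^ p)).
    apply: le_trans (james_inorm_superadditive x ab bc); rewrite lerD2l.
    by apply: (ler_powR_exp p1) => //; rewrite mulr_ge0// ltW.
  exact: (ler_powR_exp p1 (james_inorm_ge0 _ _ _) acN).
- move=> eps eps0.
  have q0 : 0 < p - 1 by rewrite subr_gt0.
  (* M >= T gives 2 ^ p * M <= (eps * M) ^ p. *)
  pose T := ((2 / eps) `^ p) `^ (p - 1)^-1.
  exists (Num.truncn T).+1 => // m x B mle mz mB.
  set M := (Num.truncn T).+1.
  have TM : T <= M%:R by rewrite ltW// truncnS_gt.
  have B0 : 0 <= B := le_trans (james_inorm_ge0 _ _ _) (mB 0%N isT).
  apply: (james_norm_le p1); first by rewrite !mulr_ge0// ltW.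
  rewrite partial_sum_blocks//.
  apply: le_trans (variation_disjoint p1 (B := fun=> B `^ p) _ _) _ => /=.
  + have mle' := leq_steps mle.
    have nz (i : 'I_M) n : partial_sum (m i) (m i.+1) x n != 0 -> (m i < n < m i.+1)%N.
      move=> nz; rewrite !ltnNge; apply/andP; split; apply: contra nz => h; apply/eqP.
        by rewrite /partial_sum big_nat_cond big1// => j; lia.
      rewrite -[RHS](mz i (ltn_ord i)) /partial_sum big_nat_cond [RHS]big_nat.
      by apply: eq_bigl => j; lia.
    move=> i j n /nz hi /nz hj; apply/val_inj => /=.
    have := mle' i.+1 j; have := mle' j.+1 i.
    by have := ltn_ord i; have := ltn_ord j; have := ltngtP i j; lia.
  + move=> i; apply: (variation_james_norm_le p1) => //; last exact: mB.
    exact: variation_partial_sum.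
  rewrite lee_fin sumr_const card_ord -[B `^ p *+ _]mulr_natl mulrA.
  rewrite !powRM ?ler0n ?(ltW eps0) ?mulr_ge0 ?(ltW eps0)//.
  rewrite ler_wpM2r ?powR_ge0//.
  have M0 : 0 < M%:R :> R by rewrite ltr0n.
  rewrite (powR_mul_pred p M0).
  rewrite mulrCA [leLHS]mulrC ler_pM2l// -ler_pdivrMl ?powR_gt0// mulrC.
  have -> : 2 `^ p = (2 / eps) `^ p * eps `^ p.
    by rewrite -powRM ?divfK ?gt_eqF ?divr_ge0 ?(ltW eps0).
  rewrite mulfK ?gt_eqF ?powR_gt0//.
  have -> : (2 / eps) `^ p = T `^ (p - 1).
    by rewrite -powRrM mulVf ?gt_eqF// powRr1 ?powR_ge0.
  by apply: ge0_ler_powR; rewrite ?nnegrE ?powR_ge0 ?ler0n ?(ltW q0).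
Qed.

End JamesIntervalNorm.

(** * From metric spaces to coordinates, and the James space *)

Lemma not_equi_lipschitz_embeds (R : realType) (k : scalar_kind)
    (W : nat -> nat -> (nat -> scalar_field R k) -> R) (C : R)
    (X : metricType (scalar_field R k)) (d : X -> X -> R)
    (coords : X -> nat -> scalar_field R k) (c1 c2 : R) :
  interval_norm W C -> 0 < c1 -> 0 < c2 ->
  (forall x y, mdist x y = ofreal k (d x y)) ->
  (forall x y b, W 0 b (coords x - coords y) <= c1 * d x y) ->
  (forall x y B, (forall b, W 0 b (coords x - coords y) <= B) -> d x y <= c2 * B) ->
  ~ equi_lipschitz_embeds
      (fun N : {N : nat | (1 <= N)%N} => tree (scalar_field R k) (sval N)) X.
Proof.
move=> IW c10 c20 mdE W_le W_ge [f [a [b [a0 b0 fab]]]].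
have aE : a = ofreal k (modulus a) by rewrite -normE gtr0_norm.
have bE : b = ofreal k (modulus b) by rewrite -normE gtr0_norm.
have pos c : 0 < c -> 0 < modulus (c : scalar_field R k).
  move=> c0; rewrite lt_neqAle modulus_ge0 andbT; apply/eqP => /esym /modulus0_eq0 cz.
  by rewrite cz ltxx in c0.
have alpha0 : 0 < modulus a / c2 by rewrite divr_gt0 ?pos.
have beta0 : 0 < c1 * modulus b by rewrite mulr_gt0 ?pos.
apply: (tree_obstruction IW alpha0 beta0) => N N0.
pose M : {N : nat | (1 <= N)%N} := exist _ N N0.
pose v (s : seq nat) : tree (scalar_field R k) N :=
  insubd (exist (fun s : seq nat => (size s <= N)%N) [::] (leq0n N)) s.
have vK s : (size s <= N)%N -> val (v s) = s.
  by move=> sN; rewrite /v val_insubd sN.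
have dv s t : (size s <= N)%N -> (size t <= N)%N ->
    modulus a * (hyperbolic_dist s t)%:R <= d (f M (v s)) (f M (v t)) <=
    modulus b * (hyperbolic_dist s t)%:R.
  move=> sN tN; have := fab M (v s) (v t).
  have -> : mdist (v s : tree (scalar_field R k) (sval M)) (v t) =
      ofreal k (hyperbolic_dist s t)%:R.
    by rewrite ofreal_nat; congr (_%:R); rewrite !vK.
  by rewrite {1}aE {1}bE mdE -!ofrealM !ler_ofreal.
exists (fun s => coords (f M (v s))); split=> s t sN tN.
  move=> c; rewrite (le_trans (W_le _ _ _))// -mulrA ler_wpM2l ?(ltW c10)//.
  by case/andP: (dv s t sN tN).
move=> B /W_ge dB; rewrite mulrAC ler_pdivrMr// mulrC.
case/andP: (dv s t sN tN) => h _; rewrite [leRHS]mulrC (le_trans _ dB)//.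
by rewrite mulrC.
Qed.

Section JamesSpaceTrees.
Variables (R : realType) (k : scalar_kind) (p : R) (p1 : 1 < p).

Definition increments (x : nat -> scalar_field R k) n := x n.+1 - x n.

Lemma partial_sum_increments a b (x : nat -> scalar_field R k) n : (a <= b)%N ->
  partial_sum a b (increments x) n = x (clip a b n) - x a.
Proof.
by move=> ab; rewrite partial_sumE// !telescope_sumr// opprB addrA subrK.
Qed.

Lemma james_inorm_increments a b (x : nat -> scalar_field R k) : (a <= b)%N ->
  (variation p x < +oo)%E -> james_inorm p a b (increments x) <= james_norm p x.
Proof.
move=> ab xfin; apply: (james_norm_le p1 (james_norm_ge0 _ _)).
rewrite (james_normX p1)//; apply: (@variation_le_map _ _ _ p1 _ _ (clip a b)).
  exact: clip_homo.
by move=> u v; rewrite !partial_sum_increments// opprB addrA subrK.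
Qed.

Lemma variation_le_james_inorm (x : nat -> scalar_field R k) m (B : R) : 0 <= B ->
  (forall b, (m <= b)%N -> james_inorm p m b (increments x) <= B) ->
  (variation p (fun n => x (maxn n m)) <= (B `^ p)%:E)%E.
Proof.
move=> B0 xB; apply: variation_le => s s0 ss.
pose b := \max_(n <- s) maxn n m.
have mb n : n \in s -> (maxn n m <= b)%N.
  by move=> ns; rewrite /b (big_rem n)//= leq_maxl.
have m_b : (m <= b)%N.
  by case: s s0 {ss xB} @b mb => // n s _ b /(_ n (mem_head _ _)); apply: leq_trans; rewrite leq_maxr.
rewrite (@eq_variation_sum _ _ _ _ (partial_sum m b (increments x))) => [|u v us vs].
  rewrite -lee_fin; apply: le_trans (variation_sum_le _ _ s0 ss) _.
  by apply: (variation_james_norm_le p1); [exact: variation_partial_sum| |exact: xB].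
rewrite !partial_sum_increments// opprB addrA subrK /clip.
by rewrite (minn_idPl (mb _ us)) (minn_idPl (mb _ vs)).
Qed.

Theorem trees_not_in_james : ~ equi_lipschitz_embeds
  (fun N : {N : nat | (1 <= N)%N} => tree (scalar_field R k) (sval N)) (james k p1).
Proof.
pose d (x y : james k p1) : R := james_norm p (x - y : james k p1).
have coordsB (x y : james k p1) :
  increments x - increments y = increments (x - y : james k p1).
  by apply/funext => n; rewrite /increments/= !fctE !opprB addrACA [RHS]addrACA [- x n + _]addrC.
apply: (@not_equi_lipschitz_embeds _ _ _ _ _ d (fun x => increments x) 1 1
  (james_inorm_interval_norm k p1)) => //.
- move=> x y b; rewrite mul1r coordsB; apply: james_inorm_increments => //.
  exact: james_seq_fin.
- move=> x y B; rewrite coordsB mul1r => dB.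
  have B0 : 0 <= B by apply: le_trans (dB 0%N); exact: james_inorm_ge0.
  apply: (james_norm_le p1) => //.
  have := @variation_le_james_inorm (x - y : james k p1) 0 B B0 (fun b _ => dB b).
  by under [X in variation p X]funext do rewrite maxn0.
Qed.

End JamesSpaceTrees.

(** * The dual interval norm *)

Section Pairing.
Variables (R : realType) (k : scalar_kind).
Implicit Types (x y z : nat -> scalar_field R k) (a b c n : nat) (r : R).

Definition restrict a b x n : scalar_field R k := if (a <= n < b)%N then x n else 0.

Lemma restrict_restrict a b c d x :
  restrict a b (restrict c d x) = restrict (maxn a c) (minn b d) x.
Proof.
apply/funext => n; rewrite /restrict.
have -> : (maxn a c <= n < minn b d)%N = (a <= n < b)%N && (c <= n < d)%N by lia.
by case: ifP.
Qed.

Lemma restrictZ a b (l : scalar_field R k) x :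
  restrict a b (fun n => l * x n) = fun n => l * restrict a b x n.
Proof. by apply/funext => n; rewrite /restrict; case: ifP; rewrite ?mulr0. Qed.

Definition pairing a b x y := \sum_(a <= j < b) x j * y j.

Lemma pairingZr a b x y (l : scalar_field R k) :
  pairing a b x (fun n => l * y n) = l * pairing a b x y.
Proof. by rewrite /pairing mulr_sumr; apply: eq_bigr => j _; rewrite mulrCA. Qed.

Lemma pairing_restrict a b c d x y : (c <= a)%N -> (a <= b)%N -> (b <= d)%N ->
  pairing c d x (restrict a b y) = pairing a b x y.
Proof.
move=> ca ab bd; rewrite /pairing (big_cat_nat ca (leq_trans ab bd))/=.
rewrite (big_cat_nat ab bd)/= big_nat big1 => [|j jc]; last first.
  by rewrite /restrict ifF ?mulr0//; lia.
rewrite add0r [X in _ + X]big_nat [X in _ + X]big1 ?addr0 => [|j jc]; last first.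
  by rewrite /restrict ifF ?mulr0//; lia.
by rewrite big_nat [RHS]big_nat; apply: eq_bigr => j jab; rewrite /restrict jab.
Qed.

Lemma phase (c : scalar_field R k) : exists2 l : scalar_field R k,
  modulus l = 1 & l * c = ofreal k (modulus c).
Proof.
have [->|c0] := eqVneq c 0; first by exists 1; rewrite ?modulus1// mul1r modulus0 ofreal0.
have mc0 : 0 < modulus c.
  rewrite lt_neqAle modulus_ge0 andbT eq_sym; apply: contra c0 => /eqP/modulus0_eq0 ->.
  exact: eqxx.
have E : ofreal k (modulus c) / c * c = ofreal k (modulus c) by rewrite divfK.
exists (ofreal k (modulus c) / c) => //.
apply: (mulIf (lt0r_neq0 mc0)); rewrite -modulusM E mul1r modulus_ofreal//.
exact: ltW.
Qed.

End Pairing.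

Section DualIntervalNorm.
Variables (R : realType) (k : scalar_kind) (p : R) (p1 : 1 < p).
Implicit Types (x y z w : nat -> scalar_field R k) (a b c n : nat) (s t v : R).

Let p0 : 0 < p. Proof. exact: lt_trans p1. Qed.

Lemma james_norm_leP x t : 0 <= t -> (variation p x <= (t `^ p)%:E)%E ->
  (variation p x < +oo)%E /\ james_norm p x <= t.
Proof. by move=> t0 xt; split; [exact: variation_lty xt|exact: james_norm_le]. Qed.

Lemma variationD_le x y s t : 0 <= s -> 0 <= t ->
  (variation p x <= (s `^ p)%:E)%E -> (variation p y <= (t `^ p)%:E)%E ->
  (variation p (x \+ y)%R <= ((s + t) `^ p)%:E)%E.
Proof.
move=> s0 t0 /(james_norm_leP s0)[xfin xs] /(james_norm_leP t0)[yfin yt].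
apply: (variation_james_norm_le p1); rewrite ?addr_ge0//.
  exact: variationD_lty.
by rewrite (le_trans (james_normD p1 xfin yfin))// lerD.
Qed.

Lemma variationZ_le (l : scalar_field R k) x t : 0 <= t ->
  (variation p x <= (t `^ p)%:E)%E ->
  (variation p (fun n => (l * x n)%R) <= ((modulus l * t) `^ p)%:E)%E.
Proof.
move=> t0 xt; rewrite variationZ powRM ?modulus_ge0// EFinM.
by apply: lee_pmul; rewrite ?lee_fin ?powR_ge0// variation_ge0.
Qed.

Lemma variation_cst (c : scalar_field R k) t : (variation p (fun=> c) <= (t `^ p)%:E)%E.
Proof.
apply: le_trans (@variation_le_map _ _ _ p1 _ (fun=> 0) id _ _) _ => //.
  by move=> u v; rewrite !subrr.
by rewrite variation_cst0// lee_fin powR_ge0.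
Qed.

Lemma variation_shifted_step a :
  (variation p (fun n => if (a <= n)%N then 1%R else 0%R : scalar_field R k) <= (1 `^ p)%:E)%E.
Proof.
rewrite powR1; apply: le_trans (variation_step k p1 a).
by apply: (@variation_le_map _ _ _ p1 _ _ succn) => // u v; rewrite !ltnS.
Qed.

(** The restriction to an interval differs from the clipped sequence by two
    multiples of steps and a constant. The sequence w is only required to vary more than x on
    [a, b); it is x itself, or a primitive, or a constant. *)
Lemma variation_restrict a b x w v : 0 <= v ->
  (forall m n, (a <= m < b)%N -> (a <= n < b)%N ->
    modulus (x n - x m) <= modulus (w n - w m)) ->
  (variation p w <= (v `^ p)%:E)%E ->
  (forall n, (a <= n < b)%N -> modulus (x n) <= v) ->
  (variation p (restrict a b x) <= ((3 * v) `^ p)%:E)%E.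
Proof.
move=> v0 xw wv xv; have [ba|ab] := leqP b a.
  have -> : restrict a b x = (fun=> 0).
    by apply/funext => n; rewrite /restrict; case: ifP => //; lia.
  by rewrite variation_cst0// lee_fin powR_ge0.
have -> : restrict a b x = ((fun n => x (clip a b.-1 n)) \+ ((fun n => - x b.-1 * (if (b <= n)%N then 1 else 0)) \+
    ((fun n => x a * (if (a <= n)%N then 1 else 0)) \+ (fun=> - x a))))%R.
  apply/funext => n /=; rewrite /restrict /clip.
  have [na|an] := ltnP n a.
    rewrite [(b <= n)%N]leqNgt (ltn_trans na ab) !mulr0 !add0r.
    by rewrite [minn _ _](_ : _ = a) ?subrr//; lia.
  have [nb|bn] := ltnP n b.
    by rewrite mulr0 add0r mulr1 subrr addr0; congr x; lia.
  by rewrite !mulr1 subrr addr0 [minn _ _](_ : _ = b.-1) ?subrr//; lia.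
have step0 (l : scalar_field R k) c : modulus l <= v ->
    (variation p (fun n => (l * (if (c <= n)%N then 1 else 0))%R) <= (v `^ p)%:E)%E.
  move=> lv; apply: le_trans (variationZ_le _ _ (variation_shifted_step c)) _ => //.
  by rewrite mulr1 lee_fin (ler_powR_exp p1)// modulus_ge0.
have -> : 3 * v = v + (v + (v + 0)) by ring.
apply: variationD_le; rewrite ?addr_ge0//.
  apply: le_trans wv; apply: (@variation_le_map _ _ _ p1 _ _ (clip a b.-1)).
    exact: clip_homo.
  by move=> m n; apply: xw; rewrite /clip; lia.
apply: variationD_le; rewrite ?addr_ge0//.
  by apply: step0; rewrite modulusN xv//; lia.
apply: variationD_le; rewrite ?addr_ge0//; last exact: variation_cst.
by apply: step0; rewrite xv// leqnn.
Qed.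

(** Bounding all restrictions to intervals makes the bound stable under such
    restrictions, without a loss of constant. *)
Definition restrict_bound x t := forall a b,
  (variation p (restrict a b x) <= (t `^ p)%:E)%E.

Lemma restrict_bound_restrict a b x t : restrict_bound x t -> restrict_bound (restrict a b x) t.
Proof. by move=> xt c d; rewrite restrict_restrict. Qed.

Lemma restrict_boundZ (l : scalar_field R k) x t : 0 <= t -> restrict_bound x t ->
  restrict_bound (fun n => l * x n) (modulus l * t).
Proof. by move=> t0 xt a b; rewrite restrictZ; exact: variationZ_le. Qed.

(** An equivalent unit ball of J_p. Finite families with disjoint supports and
    total p-th power at most 1 are allowed, so that concatenating two elements
    with coefficients s, t such that s^p + t^p <= 1 stays in the set; the
    original ball only has this property up to a constant, which would spoil
    the convexity of the dual norm. *)
Definition disjoint_ball : set (nat -> scalar_field R k) :=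
  [set y | exists (I : finType) (x : I -> nat -> scalar_field R k) (t : I -> R),
    [/\ (forall i, 0 <= t i), \sum_i t i `^ p <= 1,
      (forall i, restrict_bound (x i) (t i)),
      (forall i j n, x i n != 0 -> x j n != 0 -> i = j) &
      y = fun n => \sum_i x i n]]%classic.

Lemma disjoint_ball_single x t : 0 <= t -> t <= 1 -> restrict_bound x t -> disjoint_ball x.
Proof.
move=> t0 t1 xt; exists unit, (fun=> x), (fun=> t); split => //.
- by have := ler_powR_exp p1 t0 t1; rewrite powR1 big_const card_unit/= addr0.
- by move=> [] [].
- by apply/funext => n; rewrite big_const card_unit/= addr0.
Qed.

Lemma disjoint_ball0 : disjoint_ball (fun=> 0).
Proof.
apply: (@disjoint_ball_single _ 0) => // a b.
rewrite (_ : restrict a b _ = (fun=> 0)); last by apply/funext => n; rewrite /restrict if_same.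
exact: variation_cst.
Qed.

Lemma disjoint_ball_variation y a b : disjoint_ball y ->
  (variation p (restrict a b y) <= (2 `^ p)%:E)%E.
Proof.
move=> [I [x [t [t0 t1 xt xdis ->]]]].
have -> : restrict a b (fun n => \sum_i x i n) = fun n => \sum_i restrict a b (x i) n.
  by apply/funext => n; rewrite /restrict; case: ifP => // _; rewrite big1.
apply: le_trans (@variation_disjoint _ _ _ p1 _ _ (fun i => t i `^ p) _ _) _.
- move=> i j n; rewrite /restrict; case: ifP; rewrite ?eqxx// => _.
  exact: xdis.
- by move=> i; exact: xt.
- by rewrite lee_fin ler_piMr// powR_ge0.
Qed.

Lemma disjoint_ball_modulus y n : disjoint_ball y -> modulus (y n) <= 2.
Proof.
move=> /(disjoint_ball_variation n n.+1) /james_norm_leP[//|yfin y2].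
apply: le_trans y2; have := modulus_le_james_norm p1 yfin (ltnSn n).
by rewrite /restrict !leqnn ltnn andbF /= sub0r modulusN.
Qed.

Lemma disjoint_ball_cat a b c y z (l m : scalar_field R k) :
  modulus l `^ p + modulus m `^ p <= 1 -> disjoint_ball y -> disjoint_ball z ->
  disjoint_ball (fun n => l * restrict a b y n + m * restrict b c z n).
Proof.
move=> lm [I [x [t [t0 t1 xt xdis ->]]]] [J [w [s [s0 s1 ws wdis ->]]]].
exists (I + J)%type.
exists (fun i => match i with inl i => fun n => l * restrict a b (x i) n
                            | inr j => fun n => m * restrict b c (w j) n end).
exists (fun i => match i with inl i => modulus l * t i | inr j => modulus m * s j end).
split.
- by case=> i; rewrite mulr_ge0 ?modulus_ge0.
- rewrite big_sumType/=; apply: le_trans lm; apply: lerD.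
    under eq_bigr do rewrite powRM ?modulus_ge0//.
    by rewrite -mulr_sumr ler_piMr ?powR_ge0.
  under eq_bigr do rewrite powRM ?modulus_ge0//.
  by rewrite -mulr_sumr ler_piMr ?powR_ge0.
- by case=> i; apply: restrict_boundZ => //; exact: restrict_bound_restrict.
- case=> i [] j n; rewrite /restrict !mulf_eq0 !negb_or => /andP[_ +] /andP[_ +].
  + by case: ifP; rewrite ?eqxx// => _ xi xj; rewrite (xdis _ _ _ xi xj).
  + by case: ifP; case: ifP; rewrite ?eqxx//; lia.
  + by case: ifP; case: ifP; rewrite ?eqxx//; lia.
  + by case: ifP; rewrite ?eqxx// => _ xi xj; rewrite (wdis _ _ _ xi xj).
- apply/funext => n; rewrite big_sumType/= -!mulr_sumr /restrict.
  by congr (_ * _ + _ * _); case: ifP => // _; rewrite big1.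
Qed.

Lemma disjoint_ball_restrict a b y : disjoint_ball y -> disjoint_ball (restrict a b y).
Proof.
move=> yB; have := @disjoint_ball_cat a b b y y 1 0.
rewrite modulus1 modulus0 powR1 powR0 ?gt_eqF// addr0 => /(_ (lexx _) yB yB).
by congr disjoint_ball; apply/funext => n; rewrite mul1r mul0r addr0.
Qed.

Definition dual_inorm a b x :=
  sup [set modulus (pairing a b x y) | y in disjoint_ball]%classic.

Lemma pairing_le_sum a b x y : disjoint_ball y ->
  modulus (pairing a b x y) <= 2 * \sum_(a <= j < b) modulus (x j).
Proof.
move=> yB; rewrite /pairing mulr_sumr.
elim/big_ind2 : _ => [|u1 u2 v1 v2 h1 h2|j _]; first by rewrite modulus0.
  by rewrite (le_trans (modulusD _ _))// lerD.
by rewrite modulusM mulrC ler_wpM2r ?modulus_ge0// disjoint_ball_modulus.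
Qed.

Lemma dual_inorm_has_sup a b x :
  has_sup [set modulus (pairing a b x y) | y in disjoint_ball]%classic.
Proof.
split; first by exists (modulus (pairing a b x (fun=> 0))), (fun=> 0) => //; exact: disjoint_ball0.
by exists (2 * \sum_(a <= j < b) modulus (x j)) => _ [y yB <-]; exact: pairing_le_sum.
Qed.

Lemma dual_inorm_ub a b x y : disjoint_ball y ->
  modulus (pairing a b x y) <= dual_inorm a b x.
Proof.
by move=> yB; apply: sup_upper_bound; [exact: dual_inorm_has_sup|exists y].
Qed.

Lemma dual_inorm_le a b x (B : R) :
  (forall y, disjoint_ball y -> modulus (pairing a b x y) <= B) -> dual_inorm a b x <= B.
Proof.
move=> xB; apply: ge_sup; first by case: (dual_inorm_has_sup a b x).
by move=> _ [y yB <-]; exact: xB.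
Qed.

Lemma dual_inorm_ge0 a b x : 0 <= dual_inorm a b x.
Proof. exact: le_trans (modulus_ge0 _) (dual_inorm_ub _ _ _ disjoint_ball0). Qed.

(** For t > 0 this is the definition, applied to z / t; the case t = 0 follows
    by letting t decrease. *)
Lemma modulus_pairing_le a b x z t : 0 <= t -> restrict_bound z t ->
  modulus (pairing a b x z) <= t * dual_inorm a b x.
Proof.
move=> t0 zt; have W0 := dual_inorm_ge0 a b x.
have pos s : 0 < s -> t <= s -> modulus (pairing a b x z) <= s * dual_inorm a b x.
  move=> s0 ts.
  have zs : disjoint_ball (fun n => ofreal k s^-1 * z n).
    apply: (@disjoint_ball_single _ (s^-1 * t)).
    - by rewrite mulr_ge0 ?invr_ge0 ?(ltW s0).
    - by rewrite mulrC ler_pdivrMr// mul1r.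
    - by have := restrict_boundZ (ofreal k s^-1) t0 zt; rewrite modulus_ofreal ?invr_ge0 ?(ltW s0).
  have := dual_inorm_ub a b x zs; rewrite pairingZr modulusM modulus_ofreal ?invr_ge0 ?(ltW s0)//.
  by rewrite mulrC ler_pdivrMr// mulrC.
apply/ler_addgt0Pr => e e0; have W10 : 0 < dual_inorm a b x + 1 by rewrite ltr_wpDl.
pose s := t + e / (dual_inorm a b x + 1).
have e0' : 0 < e / (dual_inorm a b x + 1) by rewrite divr_gt0.
rewrite (le_trans (pos s _ _))// /s ?ltr_wpDl ?lerDl ?(ltW e0')// mulrDl lerD2l.
by rewrite mulrAC ler_pdivrMr// ler_pM2l// lerDl.
Qed.

Lemma restrict_bound_cst1 : restrict_bound (fun=> 1) 3.
Proof.
move=> a b; rewrite -[X in X `^ p](mulr1 3).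
apply: (@variation_restrict a b _ (fun=> 0)) => //.
- by move=> m n _ _; rewrite !subrr.
- exact: variation_cst.
- by move=> n _; rewrite modulus1.
Qed.

Lemma mul_dual_inorm_le a b x r (B : R) : 0 <= r ->
  (forall y, disjoint_ball y -> r * modulus (pairing a b x y) <= B) ->
  r * dual_inorm a b x <= B.
Proof.
move=> r0 xB; have [rz|rN0] := eqVneq r 0.
  by have := xB _ disjoint_ball0; rewrite rz !mul0r.
have r_gt0 : 0 < r by rewrite lt_neqAle eq_sym rN0.
rewrite mulrC -ler_pdivlMr//; apply: dual_inorm_le => y yB.
by rewrite ler_pdivlMr// mulrC xB.
Qed.

(** Two test sequences, rotated to make both pairings nonnegative, are
    concatenated into one. *)
Lemma dual_inorm_superadditive a b c x (s t : R) : (a <= b)%N -> (b <= c)%N ->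
  0 <= s -> 0 <= t -> s `^ p + t `^ p <= 1 ->
  s * dual_inorm a b x + t * dual_inorm b c x <= dual_inorm a c x.
Proof.
move=> ab bc s0 t0 st1; rewrite -lerBrDr; apply: mul_dual_inorm_le => // y yB.
rewrite lerBrDr addrC -lerBrDr; apply: mul_dual_inorm_le => // z zB; rewrite lerBrDr addrC.
have [l l1 lE] := phase (pairing a b x y); have [m m1 mE] := phase (pairing b c x z).
have ls : modulus (ofreal k s * l) = s by rewrite modulusM l1 mulr1 modulus_ofreal.
have mt : modulus (ofreal k t * m) = t by rewrite modulusM m1 mulr1 modulus_ofreal.
have := @disjoint_ball_cat a b c y z (ofreal k s * l) (ofreal k t * m).
rewrite ls mt => /(_ st1 yB zB) /(dual_inorm_ub a c x).
have -> : pairing a c x (fun n => ofreal k s * l * restrict a b y n + ofreal k t * m * restrict b c z n)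
    = ofreal k (s * modulus (pairing a b x y) + t * modulus (pairing b c x z)).
  rewrite ofrealD !ofrealM -lE -mE !mulrA -(@pairing_restrict _ _ a b a c x y)//.
  rewrite -(@pairing_restrict _ _ b c a c x z)// -!pairingZr /pairing -big_split/=.
  by apply: eq_bigr => j _; rewrite mulrDr.
by rewrite modulus_ofreal// addr_ge0// mulr_ge0 ?modulus_ge0.
Qed.

Lemma dual_inorm_mono a' a b b' x : (a' <= a)%N -> (a <= b)%N -> (b <= b')%N ->
  dual_inorm a b x <= dual_inorm a' b' x.
Proof.
move=> a'a ab bb'; apply: dual_inorm_le => y yB.
rewrite -(@pairing_restrict _ _ a b a' b' x y)//.
by apply: dual_inorm_ub; exact: disjoint_ball_restrict.
Qed.

Lemma dual_inorm_cat a b c x : (a <= b)%N -> (b <= c)%N ->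
  dual_inorm a c x <= dual_inorm a b x + dual_inorm b c x.
Proof.
move=> ab bc; apply: dual_inorm_le => y yB; rewrite /pairing (big_cat_nat ab bc)/=.
by rewrite (le_trans (modulusD _ _))// lerD// dual_inorm_ub.
Qed.

(** Apply [dual_inorm_superadditive] with t = tau and s = 1 - tau^p. This pair
    is admissible since s^p <= s, and s is close to 1 to the order p > 1 in tau
    while the tail contributes tau * kap * N. *)
Lemma dual_inorm_convex kap : 0 < kap <= 1 ->
  exists2 theta, 0 <= theta < 1 & forall a b c x N,
    (a <= b)%N -> (b <= c)%N -> dual_inorm a c x <= N ->
    kap * N <= dual_inorm b c x -> dual_inorm a b x <= theta * N.
Proof.
move=> /andP[kap0 kap1]; have q0 : 0 < p - 1 by rewrite subr_gt0.
(* Then tau ^ p = tau * kap / 2. *)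
pose tau := (kap / 2) `^ (p - 1)^-1.
have k2 : 0 < kap / 2 by rewrite divr_gt0.
have tau0 : 0 < tau by rewrite powR_gt0.
have tauq : tau `^ (p - 1) = kap / 2.
  by rewrite /tau -powRrM mulVf ?gt_eqF// powRr1// ltW.
have taup : tau `^ p = tau * (kap / 2).
  by rewrite -tauq; exact: powR_mul_pred.
have tau1 : tau < 1.
  rewrite ltNge; apply/negP => tau1.
  have := ge0_ler_powR (ltW q0) _ _ tau1; rewrite !nnegrE powR1 tauq (ltW tau0).
  by move=> /(_ ler01 isT); lra.
have tk : 0 < tau * kap < 1.
  by rewrite mulr_gt0//= (le_lt_trans _ tau1)// ler_piMr// ltW.
exists ((1 - tau * kap) / (1 - tau * (kap / 2))).
  apply/andP; split; first by rewrite divr_ge0//; nra.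
  by rewrite ltr_pdivrMr; nra.
move=> a b c x N ab bc acN bcN; rewrite mulrAC ler_pdivlMr; last by nra.
have taup01 : 0 < 1 - tau `^ p <= 1 by rewrite taup; nra.
have /andP[taup0 _] := taup01.
have st1 : (1 - tau `^ p) `^ p + tau `^ p <= 1.
  by rewrite -lerBrDr; apply: ge1r_powR => //; exact: ltW.
have h := dual_inorm_superadditive x ab bc (ltW taup0) (ltW tau0) st1.
have : tau * (kap * N) <= tau * dual_inorm b c x by rewrite ler_pM2l.
by move: h; rewrite taup; nra.
Qed.

End DualIntervalNorm.

(** * Blocks of sum zero in the dual *)

Section DualBlocks.
Variables (R : realType) (k : scalar_kind) (p : R) (p1 : 1 < p).
Implicit Types (x y z : nat -> scalar_field R k) (a b c n : nat) (s t v : R).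

Let p0 : 0 < p. Proof. exact: lt_trans p1. Qed.

Lemma james_inorm_blocks_ge (m : nat -> nat) M x :
  (forall i, (i < M)%N -> (m i <= m i.+1)%N) ->
  \sum_(i < M) james_inorm p (m i) (m i.+1) x `^ p <= james_inorm p (m 0%N) (m M) x `^ p.
Proof.
elim: M => [|M IH] mle; first by rewrite big_ord0 powR_ge0.
have mle' i : (i < M)%N -> (m i <= m i.+1)%N by move=> iM; apply: mle; exact: ltnW.
have m0M : (m 0%N <= m M)%N by exact: (leq_steps mle').
rewrite big_ord_recr/=; apply: le_trans (james_inorm_superadditive p1 x m0M (mle M (ltnSn _))).
by rewrite lerD2r IH.
Qed.

Lemma restrict_bound_recenter m m' y : (m <= m')%N ->
  restrict_bound p (restrict m m' (fun n => y n - y m))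
    (3 * james_inorm p m m' (increments y)).
Proof.
move=> mm' a b; rewrite restrict_restrict.
set w := partial_sum m m' (increments y).
have wfin : (variation p w < +oo)%E by exact: variation_partial_sum.
have wE n : (m <= n <= m')%N -> w n = y n - y m.
  by move=> nm; rewrite /w partial_sum_increments//; congr (y _ - _); rewrite /clip; lia.
apply: (@variation_restrict _ _ _ p1 _ _ _ w); first exact: james_inorm_ge0.
- move=> i j hi hj; rewrite !wE //; try lia.
- apply: (variation_james_norm_le p1) => //; exact: james_inorm_ge0.
- move=> n hn; have [->|nm] := eqVneq n m; first by rewrite subrr modulus0 james_inorm_ge0.
  have mn : (m < n)%N by lia.
  have := modulus_le_james_norm p1 wfin mn; rewrite !wE ?subrr ?subr0//; lia.
Qed.

(** As the coordinates of x in a block have sum 0, the test sequence y may be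
    recentred there, so that the pairing is at most 3 v i B, where v i is the
    variation of y on the block. The p-th powers of the v i have sum at most
    2^p, and v <= delta + v^p * delta^(1 - p) replaces the Hoelder inequality
    to show that the sum of the v i is o(M). *)
Lemma dual_inorm_blocks (eps : R) : 0 < eps -> exists2 M, (0 < M)%N &
  forall (m : nat -> nat) x B, (forall i, (i < M)%N -> (m i <= m i.+1)%N) ->
    (forall i, (i < M)%N -> \sum_(m i <= j < m i.+1) x j = 0) ->
    (forall i, (i < M)%N -> dual_inorm p (m i) (m i.+1) x <= B) ->
    dual_inorm p (m 0%N) (m M) x <= eps * M%:R * B.
Proof.
move=> eps0; pose delta := eps / 6; have delta0 : 0 < delta by rewrite divr_gt0.
pose T := 6 / eps * (2 `^ p * delta `^ (1 - p)).
exists (Num.truncn T).+1 => // m x B mle mz mB; set M := (Num.truncn T).+1.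
have TM : T <= M%:R by rewrite ltW// truncnS_gt.
have B0 : 0 <= B := le_trans (dual_inorm_ge0 p1 _ _ _) (mB 0%N isT).
apply: (dual_inorm_le p1) => y yB.
(* Truncating y makes its variation finite without changing any block. *)
pose v i := james_inorm p (m i) (m i.+1) (increments (restrict 0 (m M) y)).
have mle' : forall i j, (i <= j)%N -> (j <= M)%N -> (m i <= m j)%N := leq_steps mle.
have v0 i : 0 <= v i by exact: james_inorm_ge0.
have vp : \sum_(i < M) v i `^ p <= 2 `^ p.
  apply: le_trans (james_inorm_blocks_ge _ mle) _.
  apply: (ler_powR_exp p1 (james_inorm_ge0 _ _ _ _)).
  have [yfin y2] := james_norm_leP p1 (ler0n _ 2) (disjoint_ball_variation p1 0 (m M) yB).
  by apply: le_trans y2; apply: (james_inorm_increments p1) => //; exact: mle'.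
have v_le i : v i <= delta + v i `^ p * delta `^ (1 - p).
  have [vd|dv] := leP (v i) delta; first by rewrite ler_wpDr// mulr_ge0 ?powR_ge0.
  have vi0 : 0 < v i := lt_trans delta0 dv.
  rewrite ler_wpDl ?(ltW delta0)//.
  have -> : 1 - p = - (p - 1) by rewrite opprB.
  rewrite powRN ler_pdivlMr ?powR_gt0//.
  rewrite (powR_mul_pred p vi0) ler_pM2l//; apply: ge0_ler_powR; rewrite ?nnegrE ?(ltW dv) ?(ltW delta0)//.
  by rewrite subr_ge0 ltW.
have block i : (i < M)%N -> modulus (pairing (m i) (m i.+1) x y) <= 3 * v i * B.
  move=> iM; have mi := mle _ iM.
  have miM : (m i.+1 <= m M)%N by exact: mle'.
  have -> : pairing (m i) (m i.+1) x y = pairing (m i) (m i.+1) x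
      (restrict (m i) (m i.+1) (fun n => restrict 0 (m M) y n - restrict 0 (m M) y (m i))).
    rewrite pairing_restrict// /pairing; set c := restrict _ _ _ (m i).
    rewrite big_nat [RHS]big_nat.
    under [RHS]eq_bigr => j jm.
      rewrite /restrict /= (_ : (j < m M)%N = true); last by lia.
      rewrite mulrBr.
      over.
    rewrite sumrB -mulr_suml -[X in _ - X * _]big_nat mz// mul0r subr0.
    by [].
  have := modulus_pairing_le p1 (m i) (m i.+1) x (mulr_ge0 (ler0n _ 3) (v0 i))
    (restrict_bound_recenter (restrict 0 (m M) y) mi).
  by move/le_trans; apply; rewrite ler_wpM2l ?mulr_ge0// mB.
have : modulus (pairing (m 0%N) (m M) x y) <= \sum_(i < M) modulus (pairing (m i) (m i.+1) x y).
  have -> : pairing (m 0%N) (m M) x y = \sum_(i < M) pairing (m i) (m i.+1) x y.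
    elim: (M) mle' => [|j IH] mle'; first by rewrite big_ord0 /pairing big_geq.
    have ij : (m 0%N <= m j)%N := mle' 0%N j (leq0n _) (leqnSn j).
    rewrite big_ord_recr/= -IH => [|i i' ii' i'j]; last by apply: mle' => //; exact: leqW.
    by rewrite /pairing (big_cat_nat ij (mle' _ _ (leqnSn j) (leqnn _))).
  elim/big_ind2 : _ => [|u1 u2 w1 w2 h1 h2|//]; first by rewrite modulus0.
  by rewrite (le_trans (modulusD _ _))// lerD.
move/le_trans; apply.
apply: (@le_trans _ _ (\sum_(i < M) 3 * v i * B)).
  by apply: ler_sum => i _; exact: block.
rewrite -mulr_suml -mulr_sumr ler_wpM2r//.
have : \sum_(i < M) v i <= M%:R * delta + 2 `^ p * delta `^ (1 - p).
  apply: le_trans (ler_sum _ (fun (i : 'I_M) _ => v_le i)) _.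
  rewrite big_split/= sumr_const card_ord -[delta *+ _]mulr_natl lerD2l -mulr_suml.
  by rewrite ler_wpM2r ?powR_ge0.
have : 2 `^ p * delta `^ (1 - p) <= M%:R * delta.
  have -> : 2 `^ p * delta `^ (1 - p) = T * delta.
    by rewrite /T /delta; field; rewrite gt_eqF.
  by rewrite ler_pM2r.
have -> : eps = 6 * delta by rewrite /delta; field.
by nra.
Qed.

Lemma dual_inorm_interval_norm : interval_norm (@dual_inorm R k p) 3.
Proof.
split.
- exact: dual_inorm_ge0.
- move=> a b x x'; apply: (dual_inorm_le p1) => y yB.
  have -> : pairing a b (x + x') y = pairing a b x y + pairing a b x' y.
    by rewrite /pairing -big_split/=; apply: eq_bigr => j _; rewrite !fctE mulrDl.
  by rewrite (le_trans (modulusD _ _))// lerD// (dual_inorm_ub p1).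
- move=> a b x; apply: (dual_inorm_le p1) => y yB.
  have -> : pairing a b (- x) y = - pairing a b x y.
    by rewrite /pairing -sumrN; apply: eq_bigr => j _; rewrite !fctE mulNr.
  by rewrite modulusN (dual_inorm_ub p1).
- exact: ler0n.
- move=> a b x; apply: (dual_inorm_le p1) => y yB.
  apply: le_trans (pairing_le_sum p1 a b x yB) _.
  rewrite ler_wpM2r ?ler_nat// sumr_ge0// => j _; exact: modulus_ge0.
- move=> a b x; have := modulus_pairing_le p1 a b x (ler0n _ 3) (restrict_bound_cst1 k p1).
  by rewrite /pairing; under eq_bigr do rewrite mulr1.
- exact: dual_inorm_mono.
- exact: dual_inorm_cat.
- exact: dual_inorm_convex.
- exact: dual_inorm_blocks.
Qed.

End DualBlocks.

(** * The dual of the James space *)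

Section DualSpaceTrees.
Variables (R : realType) (k : scalar_kind) (p : R) (p1 : 1 < p).
Implicit Types (b n : nat) (f g : dual_space (james k p1)).

Let p0 : 0 < p. Proof. exact: lt_trans p1. Qed.

Lemma variation_restrict_lty b (y : nat -> scalar_field R k) :
  (variation p (restrict 0 b y) < +oo)%E.
Proof.
apply: le_lt_trans (variation_partial_sum p1 0 b (increments (restrict 0 b y))).
apply: (@variation_le_map _ _ _ p1 _ _ id) => // u v.
rewrite !partial_sum_increments// opprB addrA subrK.
suff E n : restrict 0 b y (clip 0 b n) = restrict 0 b y n by rewrite !E.
rewrite /restrict /clip maxn0.
by case: (ltnP n b) => nb; rewrite ?nb ?ltnn ?andbF.
Qed.

Lemma is_james_restrict b (y : nat -> scalar_field R k) :
  restrict 0 b y \in is_james_pred k p1.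
Proof.
rewrite inE; split; last exact: variation_restrict_lty.
apply: cvg_near_cst; exists b => // n /= bn.
by rewrite /restrict ltnNge bn.
Qed.

Definition james_truncation b (y : nat -> scalar_field R k) : james k p1 :=
  James (is_james_restrict b y).

Definition unit_vector n := james_truncation n.+1 (fun j => if j == n then 1 else 0).

Definition dual_coords f n : scalar_field R k := f (unit_vector n).

Lemma dual_fun_truncation f b y :
  f (james_truncation b y) = pairing 0 b (dual_coords f) y.
Proof.
elim: b => [|b IH].
  rewrite /pairing big_geq// (_ : james_truncation 0 y = 0) ?dual_fun0//.
  by apply: val_inj; apply/funext => n.
have -> : james_truncation b.+1 y = y b *: unit_vector b + james_truncation b y.
  apply: val_inj; apply/funext => n.
  transitivity (y b * restrict 0 b.+1 (fun j => if j == b then 1 else 0) n + restrict 0 b y n);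
    last by [].
  rewrite /= /restrict /= ltnS; case: (ltngtP n b) => [nb|nb|->];
    by rewrite ?mulr0 ?mulr1 ?add0r ?addr0.
rewrite dual_fun_linear IH /pairing big_nat_recr//= addrC; congr (_ + _).
by rewrite [RHS]mulrC.
Qed.

(** All values are within the norm of values that tend to 0. *)
Lemma modulus_le_james (x : james k p1) n : modulus (x n) <= james_norm p x.
Proof.
apply/ler_addgt0Pr => e e0.
have /cvgrPdist_lt/(_ _ (ofreal_gt0 k e0))[m _ xm] := james_seq_cvg x.
have nm : (n < maxn m n.+1)%N by rewrite leq_maxr.
have := xm _ (leq_maxl m n.+1); rewrite /= sub0r normrN normE => /ltW; rewrite ler_ofreal => xme.
rewrite -(modulusN (x n)) -[- x n](addrK (x (maxn m n.+1))) (le_trans (modulusD _ _))//.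
rewrite modulusN lerD// addrC.
exact: (modulus_le_james_norm p1 (james_seq_fin x)).
Qed.

(** Finitely supported sequences are dense: the variation of x far out is small
    by [inorm_tail], and so is the value at which it is cut. *)
Lemma james_norm_truncation_le (x : james k p1) (e : R) : 0 < e ->
  exists b, james_norm p (x - james_truncation b x : james k p1) <= e.
Proof.
move=> e0; have e2 : 0 < e / 2 by rewrite divr_gt0.
have xbound b : james_inorm p 0 b (increments x) <= james_norm p x.
  by apply: (james_inorm_increments p1) => //; exact: james_seq_fin.
have [m0 Hm0] := inorm_tail (james_inorm_interval_norm k p1) xbound e2.
have /cvgrPdist_lt/(_ _ (ofreal_gt0 k e2))[m1 _ xm] := james_seq_cvg x.
pose m := maxn m0 m1; exists m.
have xme : modulus (x m) <= e / 2.
  by have := xm _ (leq_maxr m0 m1); rewrite /= sub0r normrN normE => /ltW; rewrite ler_ofreal.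
have tail := variation_le_james_inorm p1 (ltW e2) (fun b => Hm0 m b (leq_maxl _ _)).
apply: (james_norm_le p1 (ltW e0)).
have -> : (x - james_truncation m x : james k p1) =
    ((fun n => x (maxn n m)) \+ ((fun n => x m * (if (m <= n)%N then 1 else 0)) \+ (fun=> - x m)))%R
    :> (nat -> scalar_field R k).
  apply/funext => n; transitivity (x n - restrict 0 m x n); first by [].
  rewrite /= /restrict /=; case: (leqP m n) => mn.
    by rewrite mulr1 subrr addr0 subr0.
  by rewrite mulr0 add0r !subrr.
have -> : e = e / 2 + (e / 2 + 0) by rewrite addr0 -splitr.
apply: (variationD_le p1); rewrite ?addr0 ?(ltW e2)//.
rewrite -[X in X `^ p]addr0; apply: (variationD_le p1); rewrite ?(ltW e2)//; last exact: variation_cst.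
apply: le_trans (variationZ_le _ _ (variation_shifted_step k p1 m)) _ => //.
by rewrite mulr1 lee_fin (ler_powR_exp p1)// modulus_ge0.
Qed.

(** By density of the finitely supported sequences, the values of a functional
    on the unit vectors determine its norm up to constants. *)
Theorem trees_not_in_james_dual : ~ equi_lipschitz_embeds
  (fun N : {N : nat | (1 <= N)%N} => tree (scalar_field R k) (sval N))
  (dual_space (james k p1)).
Proof.
pose d f g : R := dual_norm (f - g).
have coordsB f g : dual_coords f - dual_coords g = dual_coords (f - g).
  by [].
have W_le f b : dual_inorm p 0 b (dual_coords f) <= 2 * dual_norm f.
  apply: (dual_inorm_le p1) => y yB; rewrite -dual_fun_truncation.
  rewrite -(ler_ofreal k) -normE (le_trans (dual_fun_le _ _))//.
  rewrite james_normE -ofrealM ler_ofreal mulrC ler_wpM2r ?dual_norm_ge0//.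
  by have [] := james_norm_leP p1 (ler0n _ 2) (disjoint_ball_variation p1 0 b yB).
have W_ge f B : (forall b, dual_inorm p 0 b (dual_coords f) <= B) -> dual_norm f <= 3 * B.
  move=> fB; apply: dual_norm_le => x x1.
  have xfin := james_seq_fin x; have x0 := james_seq_cvg x.
  have {x1} x1 : james_norm p x <= 1 by rewrite -(ler_ofreal k) ofreal1.
  have xn n : modulus (x n) <= 1 by apply: le_trans x1; exact: modulus_le_james.
  have x3 : restrict_bound p x 3.
    move=> a b; rewrite -[X in X `^ p](mulr1 3).
    apply: (@variation_restrict _ _ _ p1 a b _ x) => //.
    by apply: (variation_james_norm_le p1).
  apply/ler_addgt0Pr => e e0.
  have D0 := dual_norm_ge0 f; have D10 : 0 < dual_norm f + 1 by rewrite ltr_wpDl.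
  have [b xb] := james_norm_truncation_le x (divr_gt0 e0 D10).
  have fx : f x = f (james_truncation b x) + f (x - james_truncation b x).
    rewrite -[f (james_truncation b x)]mul1r -[X in X + _]/(1 *: (f (james_truncation b x) : (scalar_field R k)^o)).
    by rewrite -dual_fun_linear scale1r addrC subrK.
  rewrite fx (le_trans (modulusD _ _))// lerD//.
    rewrite dual_fun_truncation (le_trans (modulus_pairing_le p1 _ _ _ (ler0n _ 3) x3))//.
    by rewrite ler_wpM2l.
  rewrite -(ler_ofreal k) -normE (le_trans (dual_fun_le _ _))//.
  rewrite james_normE -ofrealM ler_ofreal.
  apply: le_trans (ler_wpM2l D0 xb) _.
  by rewrite mulrCA ler_piMr ?(ltW e0)// ler_pdivrMr// mul1r lerDl.
apply: (@not_equi_lipschitz_embeds _ _ _ _ _ d dual_coords 2 3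
  (dual_inorm_interval_norm k p1)) => //.
- by move=> f g b; rewrite coordsB.
- by move=> f g B; rewrite coordsB; exact: W_ge.
Qed.

End DualSpaceTrees.

Theorem theorem1p5 (R : realType) (k : scalar_kind) (p : R) (p1 : 1 < p) :
  ~ equi_lipschitz_embeds
      (fun N : {N : nat | (1 <= N)%N} => tree (scalar_field R k) (sval N))
      (james k p1) /\
  ~ equi_lipschitz_embeds
      (fun N : {N : nat | (1 <= N)%N} => tree (scalar_field R k) (sval N))
      (dual_space (james k p1)).
Proof. by split; [exact: trees_not_in_james|exact: trees_not_in_james_dual]. Qed.
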